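(* Let $(M,\mathcal{T})$ be an ideally triangulated compact $3$-manifold with boundary, all of whose boundary components have negative Euler characteristic. For every initial hyper-ideal polyhedral metric $l_0\in\mathcal{L}(M,\mathcal{T})$, the solution of the combinatorial Ricci flow $\frac{dl_e}{dt}=K_e(l)$ $(e\in E)$ with $l(0)=l_0$ can be extended to a solution existing for all time $t\in[0,+\infty)$, in the following sense: there is a $C^1$ curve $\widetilde{l}:[0,+\infty)\to\mathbb{R}^E$ with $\widetilde{l}(0)=l_0$ solving the extended combinatorial Ricci flow $\frac{dl_e}{dt}=\widetilde{K}_e(l)$ $(e\in E)$ for all $t\ge 0$, and $\widetilde{l}(t)$ equals the solution $l(t)$ of the combinatorial Ricci flow whenever $l(t)$ exists in $\mathcal{L}(M,\mathcal{T})$.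
   Context: Hyper-ideal tetrahedra. A hyper-ideal tetrahedron is a compact convex polyhedron in $\mathbb{H}^3$ diffeomorphic to a truncated Euclidean tetrahedron, with four right-angled hexagonal faces and four triangular faces (vertex triangles $\Delta_1,\dots,\Delta_4$), each triangular face being orthogonal to its three adjacent hexagonal faces. Its six edges are the pairwise intersections of hexagonal faces; $l_{ij}=l_{ji}$ is the length of the edge joining $\Delta_i$ and $\Delta_j$, and $a_{ij}\in(0,\pi)$ is the dihedral angle there. The tetrahedron is determined up to isometry by $(l_{12},\dots,l_{34})$. Let $\mathcal{L}\subset\mathbb{R}^6_{>0}$ be the (open) set of six-tuples that are the edge lengths of a nondegenerate hyper-ideal tetrahedron; $a_{ij}$ is a function on $\mathcal{L}$. Triangulations. An ideally triangulated compact $3$-manifold with boundary $(M,\mathcal{T})$ is a compact $3$-manifold $M$ with boundary presented as the quotient of a finite set $T$ of truncated tetrahedra by gluing their hexagonal faces in pairs, so that the vertex triangles give a triangulation of $\partial M$. $E$ is the (finite) set of edges: equivalence classes, under gluing, of the edges arising as intersections of two hexagonal faces. For $l\in\mathbb{R}^E$ and $\sigma\in T$, $l_\sigma\in\mathbb{R}^6$ is the vector of values of $l$ on the six edges of $\sigma$. A hyper-ideal polyhedral metric is an $l\in\mathbb{R}^E_{>0}$ with $l_\sigma\in\mathcal{L}$ for all $\sigma\in T$; $\mathcal{L}(M,\mathcal{T})$ is the set of these. The combinatorial Ricci curvature of $l\in\mathcal{L}(M,\mathcal{T})$ at $e\in E$ is $K_e(l)=2\pi-(\text{sum of all dihedral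 angles at } e)$, the sum being over all edges of tetrahedra identified to $e$. Extension of angles. For $l\in\mathbb{R}^6_{>0}$ and $\{i,j,k,h\}=\{1,2,3,4\}$ let $\cosh x^i_{jk}=\frac{\cosh l_{ij}\cosh l_{ik}+\cosh l_{jk}}{\sinh l_{ij}\sinh l_{ik}}$ with $x^i_{jk}>0$, and $\phi_{ij}(l)=\frac{\cosh x^i_{jk}\cosh x^i_{jh}-\cosh x^i_{kh}}{\sinh x^i_{jk}\sinh x^i_{jh}}$ (this is symmetric in $i,j$). On $\mathcal{L}$, $\phi_{ij}=\cos a_{ij}$. Extend $a_{ij}$ to $\mathbb{R}^6_{>0}$ by $a_{ij}=0$ where $\phi_{ij}\ge 1$ and $a_{ij}=\pi$ where $\phi_{ij}\le -1$, and then continuously to $\mathbb{R}^6_{\ge 0}$. For $l\in\mathbb{R}^6$ put $\widetilde{a}_{ij}(l)=a_{ij}(l^+)$ with $l^+_{ij}=\max\{0,l_{ij}\}$; this is a continuous function on $\mathbb{R}^6$. (Equivalently, $\widetilde a_{ij}(l)=\arccos(\max\{-1,\min\{1,\phi_{ij}(l^+)\}\})$, where, with $c_{ab}=\cosh l_{ab}$, $\phi_{ij}=\frac{c_{ij}(c_{ik}c_{jh}+c_{jk}c_{ih})+c_{jk}c_{jh}+c_{ik}c_{ih}+c_{kh}-c_{ij}^2c_{kh}}{\sqrt{D_{ijk}D_{ijh}}}$ and $D_{abc}=2c_{ab}c_{bc}c_{ac}+c_{ab}^2+c_{bc}^2+c_{ac}^2-1$.) For $l\in\mathbb{R}^E$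 (a generalized hyper-ideal polyhedral metric), the generalized combinatorial Ricci curvature at $e\in E$ is $\widetilde{K}_e(l)=2\pi-\sum\widetilde{a}_{ij}(l_\sigma)$, summed over all edges $\{ij\}$ of tetrahedra $\sigma\in T$ identified to $e$. It extends $K_e$ continuously to $\mathbb{R}^E$. *)

(* Defs.v *)
From HB Require Import structures.
From Stdlib Require Import Relations.Relation_Operators.
From mathcomp Require Import all_boot all_order all_algebra all_fingroup.
From mathcomp Require Import all_classical all_reals all_analysis.

Set Implicit Arguments.
Unset Strict Implicit.
Unset Printing Implicit Defensive.

Import Order.TTheory GRing.Theory Num.Theory.
Import numFieldNormedType.Exports.

Local Open Scope classical_set_scope.
Local Open Scope ring_scope.

Definition tedge : predArgType := {A : {set 'I_4} | #|A| == 2%N}.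

Lemma card_tedge01 : #|([set ord0; ord_max] : {set 'I_4})%SET| == 2%N.
Proof. by rewrite cards2. Qed.

(* [ij i j] is the edge {i, j}; its value when i = j is irrelevant. *)
Definition ij (i j : 'I_4) : tedge :=
  insubd (Sub [set ord0; ord_max]%SET card_tedge01 : tedge) [set i; j]%SET.

Definition two_elements (A : {set 'I_4}) : 'I_4 * 'I_4 :=
  (nth ord0 (enum A) 0%N, nth ord0 (enum A) 1%N).

Definition ends (e : tedge) := two_elements (val e).
Definition opposite_ends (e : tedge) := two_elements (~: val e)%SET.

Section Hyperbolic.
Variable R : realType.
Implicit Types (x y n : 'rV[R]_4) (l : tedge -> R).

Definition cosh (t : R) : R := (expR t + expR (- t)) / 2.
Definition sinh (t : R) : R := (expR t - expR (- t)) / 2.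
Definition arcosh (c : R) : R := ln (c + Num.sqrt (c ^+ 2 - 1)).

(* the Minkowski form of signature (3,1), with time coordinate 0 *)
Definition mink x y : R :=
  \sum_(i < 4 | i != 0) x 0 i * y 0 i - x 0 0 * y 0 0.

Definition H3 : set 'rV[R]_4 := [set x | mink x x = -1 /\ 0 < x 0 0].

Definition hdist x y : R := arcosh (- mink x y).

Definition halfspace n : set 'rV[R]_4 := [set x | H3 x /\ mink x n <= 0].

(* convex hull in the hyperboloid model: the cone over the points p i, cut by
   H3 *)
Definition hconv (I : finType) (P : pred I) (p : I -> 'rV[R]_4) :
    set 'rV[R]_4 :=
  [set x | H3 x /\ exists c : I -> R,
     (forall i, 0 <= c i) /\ x = \sum_(i | P i) c i *: p i].

(* [hexn k] is the outward unit normal of the hexagonal face that misses the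
   vertex triangle k, [trin i] that of the vertex triangle i, and [vtx i j],
   for i != j, is the endpoint on the triangle i of the edge joining the
   triangles i and j. *)
Record truncated_data := TruncatedData {
  hexn : 'I_4 -> 'rV[R]_4;
  trin : 'I_4 -> 'rV[R]_4;
  vtx : 'I_4 -> 'I_4 -> 'rV[R]_4 }.

Definition polyhedron (D : truncated_data) : set 'rV[R]_4 :=
  (\bigcap_(k in [set: 'I_4]) halfspace (hexn D k)) `&`
  (\bigcap_(i in [set: 'I_4]) halfspace (trin D i)).

(* The polyhedron has the twelve vertices [vtx i j], and their incidences with
   the eight faces are those of a truncated tetrahedron.  Orthogonality of the
   vertex triangles to the adjacent hexagons makes the hexagons right-angled. *)
Record hyperideal (D : truncated_data) : Prop := Hyperideal {
  hexn_unit : forall k, mink (hexn D k) (hexn D k) = 1;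
  trin_unit : forall i, mink (trin D i) (trin D i) = 1;
  vtx_H3 : forall i j, i != j -> H3 (vtx D i j);
  polyhedron_hull : polyhedron D =
    hconv (fun q : 'I_4 * 'I_4 => q.1 != q.2) (fun q => vtx D q.1 q.2);
  vtx_on_tri : forall i j, i != j -> mink (vtx D i j) (trin D i) = 0;
  vtx_off_tri : forall i j m, i != j -> m != i ->
    mink (vtx D i j) (trin D m) < 0;
  vtx_on_hex : forall i j m, i != j -> m != i -> m != j ->
    mink (vtx D i j) (hexn D m) = 0;
  vtx_off_hex : forall i j, i != j ->
    mink (vtx D i j) (hexn D i) < 0 /\ mink (vtx D i j) (hexn D j) < 0;
  tri_orth_hex : forall i k, i != k -> mink (trin D i) (hexn D k) = 0 }.

Definition edge_length (D : truncated_data) (e : tedge) : R :=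
  let: (i, j) := ends e in hdist (vtx D i j) (vtx D j i).

(* The edge {i, j} lies on the hexagonal faces k and h, for {k, h} the
   complement of {i, j}; the interior angle is pi minus the angle between the
   outward normals. *)
Definition dihedral_angle (D : truncated_data) (e : tedge) : R :=
  let: (k, h) := opposite_ends e in pi - acos (mink (hexn D k) (hexn D h)).

Definition positive : set (tedge -> R) := [set l | forall e, 0 < l e].

Definition hyperideal_lengths : set (tedge -> R) :=
  [set l | positive l /\
     exists D, hyperideal D /\ forall e, edge_length D e = l e].

(* The angles depend only on l since a hyper-ideal tetrahedron is determined up
   to isometry by its edge lengths. *)
Definition angle l (e : tedge) : R :=
  get [set a | exists D, [/\ hyperideal D,
    forall e', edge_length D e' = l e' & a = dihedral_angle D e]].

Definition xlen l (i j k : 'I_4) : R :=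
  arcosh ((cosh (l (ij i j)) * cosh (l (ij i k)) + cosh (l (ij j k))) /
          (sinh (l (ij i j)) * sinh (l (ij i k)))).

Definition phi l (e : tedge) : R :=
  let: (i, j) := ends e in let: (k, h) := opposite_ends e in
  (cosh (xlen l i j k) * cosh (xlen l i j h) - cosh (xlen l i k h)) /
  (sinh (xlen l i j k) * sinh (xlen l i j h)).

Definition angle_pos l (e : tedge) : R :=
  if 1 <= phi l e then 0 else if phi l e <= -1 then pi else acos (phi l e).

(* [angle_pos] is continuous on positive six-tuples, and its continuous
   extension to nonnegative ones is the limit along positive six-tuples. *)
Definition angle_nonneg l (e : tedge) : R :=
  lim ((fun m : tedge -> R => angle_pos m e) @
    within positive
      (nbhs (l : prod_topology (fun _ : tedge => (R : topologicalType))))).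

Definition angle_ext l (e : tedge) : R :=
  angle_nonneg (fun e' => Num.max 0 (l e')) e.

End Hyperbolic.

(* [glue s k = (s', p)]: the hexagonal face of s opposite to the vertex k is
   identified with the face of s' opposite to p k, each vertex i != k of s
   being sent to the vertex p i of s'. *)
Record gluing (T : finType) := Gluing {
  glue : T -> 'I_4 -> T * {perm 'I_4};
  glueK : forall s k,
    glue (glue s k).1 ((glue s k).2 k) = (s, ((glue s k).2)^-1%g);
  glue_neq : forall s k, ((glue s k).1, (glue s k).2 k) <> (s, k) }.

Section Manifold.
Variables (R : realType) (M : topologicalType).

(* The model truncated tetrahedron, in barycentric coordinates: its hexagonal
   faces are x_k = 0 and its vertex triangles are x_i = 2/3. *)
Definition trunc_tet : set 'rV[R]_4 :=
  [set x | \sum_i x 0 i = 1 /\ forall i, 0 <= x 0 i <= 2 / 3].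

Definition glued_points (T : finType) (g : gluing T) (u v : T * 'rV[R]_4) :=
  exists k : 'I_4, u.2 0 k = 0 /\
    v = ((glue g u.1 k).1, col_perm ((glue g u.1 k).2)^-1%g u.2).

Definition homeomorphic_sets (X Y : topologicalType) (A : set X) (B : set Y) :=
  exists (f : X -> Y) (g : Y -> X),
    [/\ forall x, A x -> B (f x) /\ g (f x) = x,
        forall y, B y -> A (g y) /\ f (g y) = y,
        {within A, continuous f} & {within B, continuous g}].

Definition upper_half_space : set 'rV[R]_3 := [set v | 0 <= v 0 0].

Definition manifold3_with_boundary : Prop :=
  hausdorff_space M /\ @second_countable M /\
  forall x : M, exists (U : set M) (W : set 'rV[R]_3),
    [/\ open U, U x, open W & homeomorphic_sets U (W `&` upper_half_space)].

Definition boundary : set M :=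
  [set x | ~ exists (U : set M) (W : set 'rV[R]_3),
     [/\ open U, U x, open W & homeomorphic_sets U W]].

Record ideal_triangulation := IdealTriangulation {
  tet : finType;
  tgluing : gluing tet;
  proj : tet -> 'rV[R]_4 -> M;
  M_compact : compact [set: M];
  M_manifold : manifold3_with_boundary;
  proj_surj : forall y, exists s x, trunc_tet x /\ proj s x = y;
  proj_eq : forall s x s' x', trunc_tet x -> trunc_tet x' ->
    proj s x = proj s' x' <->
    clos_refl_sym_trans _ (glued_points tgluing) (s, x) (s', x');
  proj_quotient : forall U : set M,
    open U <-> forall s, open (proj s @^-1` U : set (subspace trunc_tet));
  boundary_triangles : boundary =
    [set y | exists s x i, [/\ trunc_tet x, x 0 i = 2 / 3 & proj s x = y]] }.

Variable Tri : ideal_triangulation.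
Local Notation T := (tet Tri).

(* The cell of the triangulated boundary cut out on the vertex triangle i of s
   by the hexagonal faces in F: the whole triangle, one of its sides or one of
   its corners according to whether #|F| is 0, 1 or 2. *)
Definition boundary_cell (c : T * 'I_4 * {set 'I_4}) : set M :=
  let: (s, i, F) := c in
  proj s @` [set x | [/\ trunc_tet x, x 0 i = 2 / 3 &
                            forall k, k \in F -> x 0 k = 0]].

Definition boundary_cells_in (C : set M) (d : nat) :
    {set T * 'I_4 * {set 'I_4}} :=
  [set c : T * 'I_4 * {set 'I_4} | [&& c.1.2 \notin c.2, (#|c.2| + d == 2)%N &
              `[< boundary_cell c `<=` C >]]]%SET.

(* the number of distinct d-cells of M contained in C *)
Definition num_cells (C : set M) (d : nat) : nat :=
  #|equivalence_partition
      (fun c c' => `[< boundary_cell c = boundary_cell c' >])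
      (boundary_cells_in C d)|.

Definition euler_char (C : set M) : int :=
  \sum_(d < 3) (-1) ^+ d * (num_cells C d)%:Z.

Definition boundary_component (C : set M) : Prop :=
  exists2 x, boundary x & C = connected_component boundary x.

Lemma imset_tedgeP (p : {perm 'I_4}) (e : tedge) : #|(p @: val e)%SET| == 2%N.
Proof. by rewrite card_imset ?(valP e)//; exact: perm_inj. Qed.

Definition perm_tedge (p : {perm 'I_4}) (e : tedge) : tedge :=
  Sub (p @: val e)%SET (imset_tedgeP p e).

Definition glued_edges : rel (T * tedge) := fun u v =>
  [exists k, (k \notin val u.2) &&
    (v == ((glue (tgluing Tri) u.1 k).1,
           perm_tedge (glue (tgluing Tri) u.1 k).2 u.2))].

(* the equivalence relation generated by [glued_edges], which is symmetric by
   [glueK] *)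
Definition edge_class (u : T * tedge) : {set T * tedge} :=
  [set v | connect glued_edges u v]%SET.

Definition edge : predArgType :=
  {C : {set T * tedge} | C \in [set edge_class u | u : T * tedge]%SET}.

Lemma edge_class_subproof u :
  edge_class u \in [set edge_class u | u : T * tedge]%SET.
Proof. exact: imset_f. Qed.

Definition edge_of (u : T * tedge) : edge :=
  Sub (edge_class u) (edge_class_subproof u).

Definition restrict (l : edge -> R) (s : T) : tedge -> R :=
  fun e => l (edge_of (s, e)).

Definition hyperideal_metric : set (edge -> R) :=
  [set l | (forall e, 0 < l e) /\
           forall s : T, hyperideal_lengths (restrict l s)].

Definition ricci (l : edge -> R) (e : edge) : R :=
  2 * pi - \sum_(u : T * tedge | edge_of u == e) angle (restrict l u.1) u.2.

Definition ricci_ext (l : edge -> R) (e : edge) : R :=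
  2 * pi - \sum_(u : T * tedge | edge_of u == e) angle_ext (restrict l u.1) u.2.

End Manifold.

Section Curves.
Variable R : realType.

(* derivative relative to J, so one-sided at the endpoints of an interval J *)
Definition has_derivative_in (J : set R) (f : R -> R) (t d : R) : Prop :=
  (f s - f t) / (s - t) @[s --> within J t^'] --> d.

Definition solves (I : Type) (J : set R) (F : (I -> R) -> I -> R)
    (l : R -> I -> R) : Prop :=
  forall t, J t -> forall i, has_derivative_in J (l ^~ i) t (F (l t) i).

Definition C1_on (I : Type) (J : set R) (l : R -> I -> R) : Prop :=
  forall i, exists2 f' : R -> R,
    (forall t, J t -> has_derivative_in J (l ^~ i) t (f' t)) &
    {within J, continuous f'}.

End Curves.

(* Main.v *)
(* Existence (Peano): the extended curvature is bounded and continuous, so the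
   Euler polygons are uniformly almost Lipschitz; their pointwise limit along an
   ultrafilter on the step sizes solves the extended flow, for all times because
   of the bound.
   Agreement with the flow: on a hyper-ideal metric the angles are arccosines of
   numbers in the open interval (-1, 1), where arccos is locally Lipschitz, so
   the extended curvature is locally Lipschitz near every hyper-ideal metric
   (arccos is not Lipschitz at -1 and 1, so this argument fails elsewhere).  Two
   solutions, one of which stays in that region, that agree at some time agree
   for a short while after it.
   Geometry: if v_i and n_k are the outward normals of the vertex triangles and
   of the hexagons, then <v_i, v_j> = - cosh l_ij, and v_i, v_j, n_k, n_h form a
   basis in whose coordinates the cosine law for the dihedral angle at ij is an
   algebraic identity. *)

Require Import Defs.
From HB Require Import structures.
From mathcomp Require Import all_boot all_order all_algebra all_fingroup.
From mathcomp Require Import all_classical all_reals all_analysis.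
From mathcomp Require Import ring lra.

Set Implicit Arguments.
Unset Strict Implicit.
Unset Printing Implicit Defensive.

Import Order.TTheory GRing.Theory Num.Theory.
Import numFieldNormedType.Exports.
Local Open Scope classical_set_scope.
Local Open Scope ring_scope.

(** * Continuity and local Lipschitz estimates in the sup distance *)

Section Lipschitz.
Context {R : realType}.

(** A relation rather than a norm: over an arbitrary [I] the supremum of the differences may be
    infinite. *)
Definition close {I : Type} (r : R) (x y : I -> R) :=
  forall i, `|x i - y i| <= r.

Definition continuous_fun_at {I : Type} (f : (I -> R) -> R) (p : I -> R) :=
  forall eps : R, 0 < eps ->
    exists2 r : R, 0 < r & forall x, close r x p -> `|f x - f p| <= eps.

(** A Lipschitz bound on a whole ball around [p], not only at [p] itself; [d] stands in for the sup
    norm of [x - y]. *)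
Definition lipschitz_fun_at {I : Type} (f : (I -> R) -> R) (p : I -> R) :=
  exists r L : R, [/\ 0 < r, 0 <= L & forall x y (d : R),
    close r x p -> close r y p -> 0 <= d -> close d x y ->
    `|f x - f y| <= L * d].

Definition lipschitz_near (g : R -> R) (c : R) :=
  exists r L : R, [/\ 0 < r, 0 <= L & forall a b,
    `|a - c| <= r -> `|b - c| <= r -> `|g a - g b| <= L * `|a - b|].

Section Combinators.
Variable I : Type.
Implicit Types (f g : (I -> R) -> R) (p x y : I -> R).

Lemma close_le (r s : R) x y : r <= s -> close r x y -> close s x y.
Proof. by move=> rs xy i; exact: le_trans (xy i) rs. Qed.

Lemma close_refl (r : R) x : 0 <= r -> close r x x.
Proof. by move=> r0 i; rewrite subrr normr0. Qed.

Lemma lipschitz_fun_at_pair f g p : lipschitz_fun_at f p ->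
  lipschitz_fun_at g p ->
  exists r L : R, [/\ 0 < r, r <= 1, 0 <= L & forall x y (d : R), close r x p ->
    close r y p -> 0 <= d -> close d x y ->
    `|f x - f y| <= L * d /\ `|g x - g y| <= L * d].
Proof.
move=> [r [L [r0 L0 fL]]] [s [M [s0 M0 gM]]].
exists (Num.min 1 (Num.min r s)), (Num.max L M); split.
- by rewrite !lt_min ltr01 r0 s0.
- by rewrite ge_min lexx.
- by rewrite le_max L0.
- move=> x y d xp yp d0 xy; split.
  + apply: le_trans (fL x y d _ _ d0 xy) _.
    * by apply: close_le xp; rewrite !ge_min lexx orbT.
    * by apply: close_le yp; rewrite !ge_min lexx orbT.
    * by rewrite ler_wpM2r// le_max lexx.
  + apply: le_trans (gM x y d _ _ d0 xy) _.
    * by apply: close_le xp; rewrite !ge_min lexx !orbT.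
    * by apply: close_le yp; rewrite !ge_min lexx !orbT.
    * by rewrite ler_wpM2r// le_max lexx orbT.
Qed.

Lemma lipschitz_fun_at_cst (c : R) p : lipschitz_fun_at (fun=> c) p.
Proof.
by exists 1, 0; split=> // x y d *; rewrite subrr normr0 mul0r.
Qed.

Lemma lipschitz_fun_at_proj i p : lipschitz_fun_at (fun x => x i) p.
Proof. by exists 1, 1; split=> // x y d _ _ _ /(_ i); rewrite mul1r. Qed.

Lemma lipschitz_fun_atD f g p : lipschitz_fun_at f p -> lipschitz_fun_at g p ->
  lipschitz_fun_at (fun x => f x + g x) p.
Proof.
move=> hf hg; have [r [L [r0 _ L0 fgL]]] := lipschitz_fun_at_pair hf hg.
exists r, (L + L); split=> //; first exact: addr_ge0.
move=> x y d xp yp d0 xy; have [fl gl] := fgL x y d xp yp d0 xy.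
have -> : f x + g x - (f y + g y) = (f x - f y) + (g x - g y) by ring.
by rewrite mulrDl; apply: le_trans (ler_normD _ _) _; exact: lerD.
Qed.

Lemma lipschitz_fun_atM f g p : lipschitz_fun_at f p -> lipschitz_fun_at g p ->
  lipschitz_fun_at (fun x => f x * g x) p.
Proof.
move=> hf hg; have [r [L [r0 r1 L0 fgL]]] := lipschitz_fun_at_pair hf hg.
(* Since [r <= 1], on the ball [f] and [g] are bounded by [|f p| + L] and [|g p| + L]; [K] dominates
   both. *)
pose K := L + `|f p| + `|g p|.
exists r, (K * L + K * L); split=> //.
  by rewrite addr_ge0// mulr_ge0// !addr_ge0.
move=> x y d xp yp d0 xy; have [fl gl] := fgL x y d xp yp d0 xy.
have [_ gx] := fgL x p r xp (close_refl p (ltW r0)) (ltW r0) xp.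
have [fy _] := fgL y p r yp (close_refl p (ltW r0)) (ltW r0) yp.
have Lr : L * r <= L by rewrite ler_piMr.
have gK : `|g x| <= K.
  have := ler_normD (g x - g p) (g p); rewrite subrK /K => h.
  by have := normr_ge0 (f p); lra.
have fK : `|f y| <= K.
  have := ler_normD (f y - f p) (f p); rewrite subrK /K => h.
  by have := normr_ge0 (g p); lra.
have -> : f x * g x - f y * g y = (f x - f y) * g x + f y * (g x - g y) by ring.
apply: le_trans (ler_normD _ _) _; rewrite !normrM mulrDl; apply: lerD.
  by rewrite mulrC -mulrA ler_pM.
by rewrite -mulrA ler_pM.
Qed.

Lemma lipschitz_fun_at_comp (h : R -> R) f p :
  lipschitz_near h (f p) -> lipschitz_fun_at f p ->
  lipschitz_fun_at (fun x => h (f x)) p.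
Proof.
move=> [s [M [s0 M0 hM]]] [r [L [r0 L0 fL]]].
(* [L + 1] instead of [L] allows [L = 0]; the radius [t] makes [f] send the ball into the interval
   where [h] is Lipschitz. *)
have L1 : 0 < L + 1 by rewrite ltr_wpDl.
pose t := Num.min r (s / (L + 1)).
have t0 : 0 < t by rewrite lt_min r0 divr_gt0.
have tr : t <= r by rewrite ge_min lexx.
have ts : L * t <= s.
  have : t <= s / (L + 1) by rewrite ge_min lexx orbT.
  rewrite ler_pdivlMr//; nra.
have fs x : close t x p -> `|f x - f p| <= s.
  move=> xp; apply: le_trans ts; apply: fL => //; last exact: ltW.
  - exact: close_le xp.
  - exact: close_refl (ltW r0).
exists t, (M * L); split=> //; first exact: mulr_ge0.
move=> x y d xp yp d0 xy; apply: le_trans (hM _ _ (fs x xp) (fs y yp)) _.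
by rewrite -mulrA ler_wpM2l//; apply: fL => //; exact: close_le tr _.
Qed.

Lemma lipschitz_fun_atN f p : lipschitz_fun_at f p ->
  lipschitz_fun_at (fun x => - f x) p.
Proof.
move=> [r [L [r0 L0 fL]]]; exists r, L; split=> // x y d xp yp d0 xy.
by rewrite -opprD normrN; exact: fL.
Qed.

Lemma lipschitz_fun_at_sum (J : Type) (s : seq J) (P : pred J)
    (F : J -> (I -> R) -> R) p :
  (forall j, lipschitz_fun_at (F j) p) ->
  lipschitz_fun_at (fun x => \sum_(j <- s | P j) F j x) p.
Proof.
move=> hF; elim: s => [|j s IH].
  under eq_fun do rewrite big_nil; exact: lipschitz_fun_at_cst.
under eq_fun do rewrite big_cons; case: (P j) => //.
exact: lipschitz_fun_atD.
Qed.

Lemma lipschitz_fun_at_continuous f p :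
  lipschitz_fun_at f p -> continuous_fun_at f p.
Proof.
move=> [r [L [r0 L0 fL]]] e e0.
have L1 : 0 < L + 1 by rewrite ltr_wpDl.
pose t := Num.min r (e / (L + 1)).
have t0 : 0 < t by rewrite lt_min r0 divr_gt0.
have tr : t <= r by rewrite ge_min lexx.
exists t => // x xp; apply: le_trans (_ : L * t <= e).
  apply: fL => //; last exact: ltW.
    exact: close_le xp.
  exact: close_refl (ltW r0).
have : t <= e / (L + 1) by rewrite ge_min lexx orbT.
rewrite ler_pdivlMr//; nra.
Qed.

Lemma continuous_fun_at_comp (h : R -> R) f p :
  {for f p, continuous h} -> continuous_fun_at f p ->
  continuous_fun_at (fun x => h (f x)) p.
Proof.
move=> /cvgrPdist_le hc fc e e0.
have [/= d d0 hd] := hc _ e0.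
have d2 : 0 < d / 2 by rewrite divr_gt0.
have [r r0 fr] := fc _ d2; exists r => // x /fr xr.
rewrite distrC; apply: hd; rewrite /= distrC.
by apply: le_lt_trans xr _; rewrite ltr_pdivrMr// ltr_pMr// ltr1n.
Qed.

Lemma continuous_fun_at_cstB (c : R) f p : continuous_fun_at f p ->
  continuous_fun_at (fun x => c - f x) p.
Proof.
move=> fc e e0; have [r r0 fr] := fc _ e0; exists r => // x /fr fx.
by rewrite opprB addrC addrA subrK distrC.
Qed.

Lemma continuous_fun_at_sum (J : Type) (s : seq J) (P : pred J)
    (F : J -> (I -> R) -> R) p :
  (forall j, continuous_fun_at (F j) p) ->
  continuous_fun_at (fun x => \sum_(j <- s | P j) F j x) p.
Proof.
move=> hF; elim: s => [|j s IH].
  by move=> e e0; exists 1 => // x _; rewrite !big_nil subrr normr0 ltW.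
under eq_fun do rewrite big_cons; case: (P j) => // e e0.
have e2 : 0 < e / 2 by rewrite divr_gt0.
have [r r0 hr] := hF j _ e2; have [t t0 ht] := IH _ e2.
exists (Num.min r t) => [|x xp]; first by rewrite lt_min r0.
have xr : close r x p by apply: close_le xp; rewrite ge_min lexx.
have xt : close t x p by apply: close_le xp; rewrite ge_min lexx orbT.
have {hr}hr := hr x xr; have {ht}ht := ht x xt.
rewrite opprD addrACA; apply: le_trans (ler_normD _ _) _; lra.
Qed.

End Combinators.

(** Lifts estimates from the six lengths of one tetrahedron to all edges, as [restrict l s] is [l]
    composed with a map of edges. *)
Lemma lipschitz_fun_at_precomp (I J : Type) (u : J -> I) (f : (J -> R) -> R)
    (p : I -> R) :
  lipschitz_fun_at f (p \o u) -> lipschitz_fun_at (fun x => f (x \o u)) p.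
Proof.
move=> [r [L [r0 L0 fL]]]; exists r, L; split=> // x y d xp yp d0 xy.
by apply: fL => // j; [exact: xp|exact: yp|exact: xy].
Qed.

Lemma max0_contraction (a b : R) : `|Num.max 0 a - Num.max 0 b| <= `|a - b|.
Proof.
rewrite /Num.max; case: (ltP 0 a) => ha; case: (ltP 0 b) => hb //.
- by rewrite subr0 !ger0_norm; lra.
- by rewrite sub0r normrN (gtr0_norm hb) ler0_norm; lra.
- by rewrite subrr normr0.
Qed.

Lemma lipschitz_near_derive (g dg : R -> R) (c r L : R) : 0 < r -> 0 <= L ->
  (forall x, `|x - c| <= r -> is_derive x 1 g (dg x) /\ `|dg x| <= L) ->
  lipschitz_near g c.
Proof.
move=> r0 L0 hg; exists r, L; split=> // a b ac bc.
wlog ab : a b ac bc / a <= b.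
  move=> W; have [|/ltW] := leP a b; first exact: W.
  by move=> ba; rewrite distrC [`|a - b|]distrC; exact: W.
rewrite distrC [`|a - b|]distrC.
have near_c x : x \in `[a, b] -> `|x - c| <= r.
  by rewrite in_itv/= => /andP[]; move: ac bc; rewrite !ler_norml; lra.
have [x||x xab ->] := @MVT_segment R g dg a b ab.
- by move=> /subset_itv_oo_cc/near_c/hg[].
- apply: derivable_within_continuous => x /near_c/hg[[]]//.
- by rewrite normrM ler_wpM2r//; have [] := hg x (near_c x xab).
Qed.

Lemma lipschitz_near_expR (c : R) : lipschitz_near expR c.
Proof.
apply: (@lipschitz_near_derive _ expR c 1 (expR (c + 1))) => //.
move=> x xc; split; first exact: is_derive_expR.
by rewrite ger0_norm ?expR_ge0// ler_expR; move: xc; rewrite ler_norml; lra.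
Qed.

Lemma lipschitz_near_sqrt (c : R) : 0 < c -> lipschitz_near Num.sqrt c.
Proof.
move=> c0; exists (c / 2), (Num.sqrt (c / 2))^-1; split=> //.
- by rewrite divr_gt0.
move=> a b; rewrite ler_norml => ac; rewrite ler_norml => bc.
have s0 : 0 < Num.sqrt (c / 2) by rewrite sqrtr_gt0 divr_gt0.
have sa : Num.sqrt (c / 2) <= Num.sqrt a by rewrite ler_wsqrtr//; lra.
have sb : 0 <= Num.sqrt b by exact: sqrtr_ge0.
rewrite mulrC ler_pdivlMr//.
(* The sum of the two roots is at least [Num.sqrt (c / 2)], already because of the root of [a]. *)
have -> : a - b = (Num.sqrt a - Num.sqrt b) * (Num.sqrt a + Num.sqrt b).
  by rewrite -subr_sqr !sqr_sqrtr//; lra.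
by rewrite normrM ler_wpM2l// ger0_norm; lra.
Qed.

Lemma lipschitz_near_inv (c : R) : 0 < c -> lipschitz_near GRing.inv c.
Proof.
move=> c0; exists (c / 2), ((c / 2) ^- 2); split=> //.
- by rewrite divr_gt0.
- by rewrite invr_ge0 exprn_ge0// divr_ge0// ltW.
move=> a b; rewrite ler_norml => ac; rewrite ler_norml => bc.
have a0 : 0 < a by lra.
have b0 : 0 < b by lra.
have ab0 := mulr_gt0 a0 b0.
have -> : a^-1 - b^-1 = (a * b)^-1 * (b - a) by field; rewrite !gt_eqF.
rewrite normrM [`|b - a|]distrC ler_wpM2r// ger0_norm ?invr_ge0 ?(ltW ab0)//.
rewrite lef_pV2 ?posrE ?exprn_gt0 ?divr_gt0//; nra.
Qed.

Lemma lipschitz_near_acos (c : R) : -1 < c < 1 -> lipschitz_near acos c.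
Proof.
move=> /andP[c1 c2]; pose r := Num.min (1 + c) (1 - c) / 2.
have r0 : 0 < r by rewrite divr_gt0// lt_min; apply/andP; split; lra.
have [r1 r2] : r <= (1 + c) / 2 /\ r <= (1 - c) / 2.
  by rewrite !ler_pM2r// !ge_min !lexx orbT.
(* Both [1 - x] and [1 + x] are at least [r], and one of them is at least 1, so their product is at
   least [r]. *)
have bnd x : `|x - c| <= r -> -1 < x < 1 /\ r <= 1 - x ^+ 2.
  rewrite ler_norml => xc; split; first by lra.
  nra.
apply: (@lipschitz_near_derive _ (fun x => - (Num.sqrt (1 - x ^+ 2))^-1) c r
  (Num.sqrt r)^-1) => //.
move=> x /bnd[x1 x2]; split; first exact: is_derive1_acos.
rewrite normrN ger0_norm ?invr_ge0 ?sqrtr_ge0//.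
have sr : 0 < Num.sqrt r by rewrite sqrtr_gt0.
have srx : Num.sqrt r <= Num.sqrt (1 - x ^+ 2) by rewrite ler_wsqrtr.
by rewrite lef_pV2 ?posrE//; exact: lt_le_trans srx.
Qed.

End Lipschitz.

(** * Peano existence by Euler polygons *)

Section Peano.
Context {R : realType}.

(** By compactness the image ultrafilter clusters at some [l], and an ultrafilter converges to its
    cluster points. One ultrafilter serves all times and coordinates at once, so no subsequence has
    to be extracted. *)
Lemma ultra_bounded_limit (U : set_system nat) (u : nat -> R) (M : R) :
  UltraFilter U -> (forall n, `|u n| <= M) ->
  exists l : R, forall e : R, 0 < e -> U [set n | `|u n - l| <= e].
Proof.
move=> UU uM; have UP : ProperFilter U by exact: ultra_proper.
have UK : (u @ U) [set` `[(- M), M]].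
  by apply: (@filterE _ U) => n; rewrite /= in_itv/= -ler_norml; exact: uM.
have [l [_ cl]] := @segment_compact R (- M) M (u @ U) _ UK.
exists l => e e0.
have [//|Un] := in_ultra_setVsetC [set n | `|u n - l| <= e] UU.
have nl : nbhs l (ball l e) by exact: nbhsx_ballx.
have [y [/= ny yl]] : ~` [set y | `|y - l| <= e] `&` ball l e !=set0.
  by apply: cl; [exact: Un|exact: nl].
by case: ny; rewrite distrC ltW.
Qed.

Variables (I : finType) (F : (I -> R) -> I -> R) (C : R) (x0 : I -> R).
Hypothesis C0 : 0 <= C.
Hypothesis FC : forall x i, `|F x i| <= C.

Fixpoint euler (h : R) (k : nat) : I -> R :=
  if k is j.+1 then fun i => euler h j i + h * F (euler h j) i else x0.

(** Each step adds an error of at most [h * e]. With [v = 0], [e = C] this gives the Lipschitz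
    bound; with [v] the value of [F] at the limit curve it gives the derivative. *)
Lemma euler_drift (h v e : R) (i : I) (k m : nat) : 0 <= h -> (k <= m)%N ->
  (forall j, (k <= j < m)%N -> `|F (euler h j) i - v| <= e) ->
  `|euler h m i - euler h k i - (m%:R * h - k%:R * h) * v|
    <= (m%:R * h - k%:R * h) * e.
Proof.
move=> h0; elim: m => [|m IH].
  by rewrite leqn0 => /eqP-> _; rewrite !subrr !mul0r subrr normr0.
rewrite leq_eqVlt => /predU1P[-> _|].
  by rewrite !subrr !mul0r subrr normr0.
rewrite ltnS => km Fv.
have Fm : `|F (euler h m) i - v| <= e by apply: Fv; rewrite km ltnSn.
rewrite /= -natr1.
set a := euler h m i; set b := F (euler h m) i.
have -> : a + h * b - euler h k i - ((m%:R + 1) * h - k%:R * h) * v =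
  (a - euler h k i - (m%:R * h - k%:R * h) * v) + h * (b - v) by ring.
have -> : ((m%:R + 1) * h - k%:R * h) * e =
  (m%:R * h - k%:R * h) * e + h * e by ring.
apply: le_trans (ler_normD _ _) _; apply: lerD.
  by apply: IH => // j /andP[kj jm]; apply: Fv; rewrite kj ltnW.
by rewrite normrM ger0_norm// ler_wpM2l.
Qed.

Lemma euler_lipschitz (h : R) (i : I) (k m : nat) : 0 <= h ->
  `|euler h m i - euler h k i| <= C * `|m%:R * h - k%:R * h|.
Proof.
move=> h0; wlog km : k m / (k <= m)%N.
  move=> W; have [|/ltnW] := leqP k m; first exact: W.
  by move=> mk; rewrite distrC [X in C * X]distrC; exact: W.
have := @euler_drift h 0 C i k m h0 km; rewrite mulr0 subr0 => D.
have d0 : 0 <= m%:R * h - k%:R * h by rewrite subr_ge0 ler_wpM2r// ler_nat.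
rewrite (ger0_norm d0) mulrC.
by apply: D => j _; rewrite subr0.
Qed.

Lemma truncn_step (h s : R) : 0 < h -> 0 <= s ->
  (Num.truncn (s / h))%:R * h <= s < (Num.truncn (s / h))%:R * h + h.
Proof.
move=> h0 s0; have sh : 0 <= s / h by rewrite divr_ge0// ltW.
have /andP[lo hi] := truncn_itv sh.
by rewrite -ler_pdivlMr// lo/= -{3}[h]mul1r -mulrDl -ltr_pdivrMr// natr1.
Qed.

Definition step (n : nat) : R := n.+1%:R^-1.
(** A step function, not interpolated: it takes the value at the last grid time up to [t]. The
    rounding error vanishes with the step. *)
Definition polygon (n : nat) (t : R) : I -> R :=
  euler (step n) (Num.truncn (t / step n)).

Lemma step_gt0 n : 0 < step n. Proof. by rewrite invr_gt0 ltr0n. Qed.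

Lemma polygon_bounded n (t : R) i : `|polygon n t i| <= `|x0 i| + C * `|t|.
Proof.
have h0 := step_gt0 n; set h := step n in h0 *.
have := euler_lipschitz i 0 (Num.truncn (t / h)) (ltW h0).
rewrite mul0r subr0 /= => L.
have kt : `|(Num.truncn (t / h))%:R * h| <= `|t|.
  rewrite ger0_norm ?mulr_ge0 ?ler0n ?(ltW h0)//.
  have [t0|t0] := leP 0 t.
    by rewrite (ger0_norm t0); have /andP[] := truncn_step h0 t0.
  (* At negative times the truncation is 0, so the polygon stays at [x0]. *)
  rewrite (_ : Num.truncn _ = 0%N) ?mul0r//.
  by apply/truncn0Pn; rewrite -ltNge; apply: lt_trans ltr01;
    rewrite pmulr_llt0 ?invr_gt0.
have {kt}kt := ler_wpM2l C0 kt.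
have := ler_normD (polygon n t i - x0 i) (x0 i).
by rewrite subrK /polygon -/h; lra.
Qed.

(** The last clause is the differential equation in terms of increments, one-sided at time 0. *)
Lemma peano_existence :
  (forall p i, continuous_fun_at (F ^~ i) p) ->
  exists x : R -> I -> R, [/\ x 0 = x0,
    forall (s t : R) i, 0 <= s -> 0 <= t -> `|x s i - x t i| <= C * `|s - t| &
    forall (t : R) i (e : R), 0 <= t -> 0 < e -> exists2 r : R, 0 < r &
      forall s, 0 <= s -> `|s - t| <= r ->
        `|x s i - x t i - (s - t) * F (x t) i| <= e * `|s - t|].
Proof.
move=> Fc.
(* [U] refines the filter of cofinite tails, so the step sizes tend to 0 along it. *)
have [U [UU Uoo]] := ultraFilterLemma (@eventually_filter).
have UP : ProperFilter U by exact: ultra_proper.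
have xlim t i : {l : R | forall e : R, 0 < e ->
    U [set n | `|polygon n t i - l| <= e]}.
  exact: cid (ultra_bounded_limit UU (fun n => polygon_bounded n t i)).
pose x t i := projT1 (xlim t i).
have Ux t (e : R) : 0 < e -> U [set n | close e (polygon n t) (x t)].
  by move=> e0; apply: filter_forall => i; exact: (projT2 (xlim t i)).
have Ustep (e : R) : 0 < e -> U [set n | step n <= e].
  move=> e0; apply: Uoo; near=> n; rewrite /= /step.
  rewrite -[e]invrK lef_pV2 ?posrE ?invr_gt0//.
  apply: ltW; apply: lt_le_trans (truncnS_gt _) _; rewrite ler_nat ltnS.
  by near: n; exact: nbhs_infty_ge.
have approx s t (e : R) : 0 < e -> exists n,
    [/\ close e (polygon n s) (x s), close e (polygon n t) (x t) & step n <= e].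
  move=> e0; have [n [[ns nt] nh]] :=
    filter_ex (filterI (filterI (Ux s e e0) (Ux t e e0)) (Ustep e e0)).
  by exists n.
exists x; split.
- apply/funext => i; apply/eqP; rewrite -subr_eq0 -normr_le0.
  apply/ler_addgt0Pr => e e0; rewrite add0r.
  have [n [/(_ i) + _ _]] := approx 0 0 e e0.
  by rewrite /polygon mul0r truncn0 distrC.
- move=> s t i s0 t0; apply/ler_addgt0Pr => e e0.
  have C2 : 0 < C + 2 by rewrite ltr_wpDl.
  (* Rounding to grid times costs [C * e'], replacing the two polygon values by their limits costs
     [2 * e']. *)
  pose e' := e / (C + 2); have e'0 : 0 < e' by rewrite divr_gt0.
  have ee' : e = C * e' + 2 * e' by rewrite /e'; field; rewrite gt_eqF.
  have [n [/(_ i) + /(_ i) + nh]] := approx s t _ e'0.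
  have h0 := step_gt0 n.
  have := euler_lipschitz i
    (Num.truncn (t / step n)) (Num.truncn (s / step n)) (ltW h0).
  have /andP[s1 s2] := truncn_step h0 s0.
  have /andP[t1 t2] := truncn_step h0 t0.
  rewrite -/(polygon n s) -/(polygon n t).
  move: (polygon n s i) (polygon n t i) => ps pt.
  move: (_ * step n) (_ * step n) s1 s2 t1 t2 => b a s1 s2 t1 t2 pst ns nt.
  have ab : `|a - b| <= `|s - t| + e'.
    have -> : a - b = (s - t) + ((a - s) - (b - t)) by ring.
    apply: le_trans (ler_normD _ _) _; rewrite lerD2l ler_norml.
    by apply/andP; split; lra.
  have {ab}ab := ler_wpM2l C0 ab.
  have -> : x s i - x t i = (ps - pt) - (ps - x s i) + (pt - x t i) by ring.
  have := ler_normD (ps - pt - (ps - x s i)) (pt - x t i).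
  have := ler_normB (ps - pt) (ps - x s i).
  lra.
move=> t i e t0 e0.
have [d d0 Fd] := Fc (x t) i e e0.
have C1 : 0 < C + 1 by rewrite ltr_wpDl.
(* Within time [r + z], where [z <= r], a polygon moves by at most [2 * (C * r)]; adding the
   approximation error [z] stays below [d]. *)
pose r := d / 2 / (C + 1); have r0 : 0 < r by rewrite !divr_gt0.
have dr : d = 2 * (C * r) + 2 * r by rewrite /r; field; rewrite gt_eqF.
have Cr : 0 <= C * r by rewrite mulr_ge0// ltW.
set v := F (x t) i.
have vC : `|v| <= C by exact: FC.
(* Taking [a = t] gives the increments to the right of [t], and [b = t] those to the left. *)
suff main (a b : R) : 0 <= a -> a <= b -> `|a - t| <= r -> `|b - t| <= r ->
    `|x b i - x a i - (b - a) * v| <= e * (b - a).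
  exists r => // s s0 st; have [ts|st'] := leP t s.
    by rewrite (@ger0_norm _ (s - t)) ?subr_ge0//; apply: main;
      rewrite ?subrr ?normr0// ltW.
  rewrite distrC [`|s - t|]distrC (@ger0_norm _ (t - s)) ?subr_ge0 ?(ltW st')//.
  have -> : (s - t) * v - (x s i - x t i) = x t i - x s i - (t - s) * v by ring.
  by apply: main; rewrite ?subrr ?normr0 ?(ltW st') ?(ltW r0).
move=> a0 ab ar br; have b0 := le_trans a0 ab.
apply/ler_addgt0Pr => y y0.
(* The error is [2 * z] from the limits at [a] and [b], [C * z] from rounding the times in front of
   [v], and [e * z] from rounding in the drift bound. *)
pose K := 2 + C + e; have K0 : 0 < K by rewrite /K; lra.
pose z := Num.min r (y / K).
have z0 : 0 < z by rewrite lt_min r0 divr_gt0.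
have zr : z <= r by rewrite ge_min lexx.
have zy : 2 * z + C * z + e * z <= y.
  have : z <= y / K by rewrite ge_min lexx orbT.
  by rewrite ler_pdivlMr// /K; lra.
have [n [[[na nb] nt] nh]] := filter_ex (filterI (filterI
  (filterI (Ux a z z0) (Ux b z z0)) (Ux t z z0)) (Ustep z z0)).
rewrite /= in nh; move/(_ i) in na; move/(_ i) in nb.
have h0 := step_gt0 n.
have /andP[a1 a2] := truncn_step h0 a0.
have /andP[b1 b2] := truncn_step h0 b0.
have /andP[t1 t2] := truncn_step h0 t0.
have km : (Num.truncn (a / step n) <= Num.truncn (b / step n))%N.
  by apply: le_truncn; rewrite ler_pM2r// invr_gt0.
have := @euler_drift (step n) v e i _ _ (ltW h0) km.
rewrite -/(polygon n a) -/(polygon n b).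
(* Grid times between [a] and [b] are close to [t], so there the polygon is within [d] of [x t],
   where [F] differs from [v] by at most [e]. *)
have Fj j : (Num.truncn (a / step n) <= j < Num.truncn (b / step n))%N ->
    `|F (euler (step n) j) i - v| <= e.
  move=> /andP[kj jm]; apply: Fd => i'.
  have := euler_lipschitz i' (Num.truncn (t / step n)) j (ltW h0).
  rewrite -/(polygon n t) => jt.
  have {}nt := nt i'.
  have jh : `|j%:R * step n - (Num.truncn (t / step n))%:R * step n| <= r + z.
    have : (Num.truncn (a / step n))%:R * step n <= j%:R * step n.
      by rewrite ler_pM2r// ler_nat.
    have : j%:R * step n <= (Num.truncn (b / step n))%:R * step n.
      by rewrite ler_pM2r// ler_nat ltnW.
    move: ar br; rewrite !ler_norml; lra.
  have {jh}jh := ler_wpM2l C0 jh.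
  have Cz := ler_wpM2l C0 zr.
  have := ler_normD (euler (step n) j i' - polygon n t i')
    (polygon n t i' - x t i').
  by rewrite addrA subrK; lra.
move=> /(_ Fj).
move: (polygon n a i) (polygon n b i) na nb => pa pb na nb.
move: (_ * step n) (_ * step n) a1 a2 b1 b2 => m k a1 a2 b1 b2 D.
have w : `|(m - k) - (b - a)| <= z by rewrite ler_norml; lra.
have wv : `|((m - k) - (b - a)) * v| <= C * z.
  by rewrite normrM mulrC ler_pM.
have we : (m - k) * e <= e * (b - a) + e * z.
  rewrite mulrC -mulrDr ler_wpM2l ?ltW//.
  by move: w; rewrite ler_norml; lra.
have -> : x b i - x a i - (b - a) * v = (pb - pa - (m - k) * v)
    + ((m - k - (b - a)) * v + (pa - x a i - (pb - x b i))) by ring.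
apply: le_trans (ler_normD _ _) _.
have := ler_normD ((m - k - (b - a)) * v) (pa - x a i - (pb - x b i)).
have := ler_normB (pa - x a i) (pb - x b i).
lra.
Unshelve. all: by end_near.
Qed.

End Peano.

(** * Derivatives within a set, the mean value inequality, and uniqueness for ODEs *)

Section Uniqueness.
Context {R : realType}.

Lemma finite_radius (I : finType) (P : I -> R -> Prop) :
  (forall i (r s : R), 0 < s -> s <= r -> P i r -> P i s) ->
  (forall i, exists2 r : R, 0 < r & P i r) ->
  exists2 r : R, 0 < r & forall i, P i r.
Proof.
move=> Pmono /(_ _)/cid2-/all_sig2[r r0 Pr].
have m0 : 0 < \big[Num.min/1]_i r i by apply/bigmin_gtP; split.
exists (\big[Num.min/1]_i r i) => // i.
by apply: Pmono (Pr i) => //; exact: bigmin_le.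
Qed.

(** Clearing the denominator makes the case [s = t] harmless. *)
Lemma has_derivative_inP (J : set R) (f : R -> R) (t d : R) :
  has_derivative_in J f t d <->
  forall e : R, 0 < e -> exists2 r : R, 0 < r &
    forall s, J s -> `|s - t| <= r ->
      `|f s - f t - (s - t) * d| <= e * `|s - t|.
Proof.
have quotient s : s != t ->
    `|d - (f s - f t) / (s - t)| * `|s - t| = `|f s - f t - (s - t) * d|.
  move=> st; rewrite -normrM distrC; congr `|_|.
  by field; rewrite subr_eq0.
rewrite /has_derivative_in; split.
  move=> /cvgrPdist_le fd e e0; have := fd e e0.
  rewrite /within/= => -[r /= r0 rP]; exists (r / 2); first by rewrite divr_gt0.
  move=> s Js sr; have [->|st] := eqVneq s t.
    by rewrite !subrr mul0r subrr normr0 mulr0.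
  rewrite -quotient// ler_wpM2r//; apply: rP => //=.
  rewrite distrC; apply: le_lt_trans sr _.
  by rewrite ltr_pdivrMr// ltr_pMr// ltr1n.
move=> fd; apply/cvgrPdist_le => e e0; have [r r0 rP] := fd e e0.
rewrite /within/=; exists r => //= s.
rewrite /ball_/= [`|t - s|]distrC => sr st Js.
have st0 : 0 < `|s - t| by rewrite normr_gt0 subr_eq0.
by rewrite /= -(ler_pM2r st0) quotient//; apply: rP => //; exact: ltW.
Qed.

Lemma has_derivative_in_subset (J K : set R) (f : R -> R) (t d : R) :
  K `<=` J -> has_derivative_in J f t d -> has_derivative_in K f t d.
Proof.
move=> KJ /has_derivative_inP fd; apply/has_derivative_inP => e /fd[r r0 rP].
by exists r => // s /KJ; exact: rP.
Qed.

Lemma has_derivative_inB (J : set R) (f g : R -> R) (t c d : R) :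
  has_derivative_in J f t c -> has_derivative_in J g t d ->
  has_derivative_in J (fun s => f s - g s) t (c - d).
Proof.
move=> fc gd; rewrite /has_derivative_in.
have -> : (fun s => (f s - g s - (f t - g t)) / (s - t)) =
    (fun s => (f s - f t) / (s - t)) \- (fun s => (g s - g t) / (s - t)).
  by apply/funext => s /=; rewrite -mulrBl; congr (_ / _); ring.
exact: cvgB.
Qed.

(** Let [c] be the supremum of the [t] such that [P] holds on all of [[a, t]]. The third premise
    gives [P c], and the second would carry [P] past [c] if [c < b]. *)
Lemma real_induction (a b : R) (P : R -> Prop) :
  P a ->
  (forall t, a <= t < b -> P t ->
    exists2 r : R, 0 < r & forall s, t <= s -> s <= t + r -> s <= b -> P s) ->
  (forall t, a < t <= b -> (forall s, a <= s < t -> P s) -> P t) ->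
  forall t, a <= t <= b -> P t.
Proof.
move=> Pa Pstep Plim t1 /andP[at1 t1b].
pose S := [set t | a <= t <= b /\ forall s, a <= s <= t -> P s].
have Sa : S a.
  split; first by rewrite lexx (le_trans at1).
  by move=> s /andP[as1 sa]; rewrite (_ : s = a)//; apply/eqP; rewrite eq_le sa.
have Sub : ubound S b by move=> t [/andP[]].
have hS : has_sup S by split; [exists a|exists b].
pose c := sup S.
have ac : a <= c by apply: ub_le_sup => //; exists b.
have cb : c <= b by apply: ge_sup => //; exists a.
have Pbelow s : a <= s < c -> P s.
  move=> /andP[as_ sc]; have e0 : 0 < c - s by rewrite subr_gt0.
  have [t [_ tP]] := sup_adherent e0 hS.
  by rewrite opprB addrC subrK => st; apply: tP; rewrite as_ ltW.
have Pc : P c.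
  have [->//|nac] := eqVneq c a.
  by apply: Plim => //; rewrite cb lt_neqAle eq_sym nac ac.
have Ple s : a <= s <= c -> P s.
  rewrite (le_eqVlt s) => /andP[as_ /predU1P[->//|sc]].
  by apply: Pbelow; rewrite as_.
suff cb' : c = b by apply: Ple; rewrite at1 cb'.
apply/eqP; rewrite eq_le cb/= leNgt; apply/negP => ltcb.
have [|r r0 rP] := Pstep c _ Pc; first by rewrite ac.
pose d := Num.min b (c + r).
have cd : c < d by rewrite lt_min ltcb ltrDl.
have : S d.
  split; first by rewrite ge_min lexx (le_trans ac (ltW cd)).
  move=> s /andP[as_ sd]; have [sc|/ltW cs] := leP s c.
    by apply: Ple; rewrite as_.
  apply: rP => //; first by apply: le_trans sd _; rewrite ge_min lexx orbT.
  by apply: le_trans sd _; rewrite ge_min lexx.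
by move=> Sd; have := ub_le_sup (ex_intro _ b Sub) Sd; rewrite leNgt cd.
Qed.

(** Real induction on the bound with slope [K + e]: the slack [e] absorbs the error of the
    derivative near each point, so [f'] may be discontinuous. *)
Lemma mean_value (a b K : R) (f f' : R -> R) : a <= b ->
  (forall t, a <= t <= b ->
    has_derivative_in [set s | a <= s <= b] f t (f' t) /\ `|f' t| <= K) ->
  `|f b - f a| <= K * (b - a).
Proof.
move=> ab fd; apply/ler_addgt0Pr => e0 e0_gt0.
(* Chosen so that [e * (b - a) <= e0]; adding 1 covers [a = b]. *)
pose e := e0 / (b - a + 1).
have ba1 : 0 < b - a + 1 by rewrite ltr_wpDl// subr_ge0.
have e_gt0 : 0 < e by rewrite divr_gt0.
have incr t : a <= t <= b -> exists2 r : R, 0 < r & forall s, a <= s <= b ->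
    `|s - t| <= r -> `|f s - f t| <= (K + e) * `|s - t|.
  move=> /fd[/has_derivative_inP/(_ e e_gt0)[r r0 rP] fK].
  exists r => // s sab st.
  have := ler_normD (f s - f t - (s - t) * f' t) ((s - t) * f' t).
  have := rP s sab st; have := ler_wpM2r (normr_ge0 (s - t)) fK.
  rewrite subrK normrM; lra.
suff : forall t, a <= t <= b -> `|f t - f a| <= (K + e) * (t - a).
  move=> /(_ b); rewrite ab lexx => /(_ isT) h; apply: le_trans h _.
  rewrite mulrDl lerD2l /e -mulrA ger_pMr// mulrC ler_pdivrMr//; lra.
have glue s t : a <= s <= t -> `|f t - f s| <= (K + e) * (t - s) ->
    `|f s - f a| <= (K + e) * (s - a) -> `|f t - f a| <= (K + e) * (t - a).
  move=> _ ts sa; have := ler_normD (f t - f s) (f s - f a).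
  rewrite addrA subrK; lra.
apply: real_induction.
- by rewrite !subrr normr0 mulr0.
- move=> t /andP[at_ tb] ft.
  have [|r r0 rP] := incr t; first by rewrite at_ ltW.
  exists r => // s ts sr sb; apply: (glue t) => //; first by rewrite at_.
  have := rP s; rewrite sb (le_trans at_ ts) ger0_norm ?subr_ge0//; apply => //.
  by rewrite lerBlDl.
- move=> t /andP[at_ tb] ft; have [|r r0 rP] := incr t; first by rewrite ltW.
  pose s := Num.max a (t - r).
  have st : s < t by rewrite gt_max at_ ltrBlDr ltrDl.
  have as_ : a <= s by rewrite le_max lexx.
  apply: (glue s); [by rewrite as_ ltW| |by apply: ft; rewrite as_].
  have ts : `|s - t| = t - s by rewrite distrC ger0_norm// subr_ge0 ltW.
  rewrite distrC; have := rP s; rewrite as_ (le_trans (ltW st) tb) ts.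
  apply => //.
  by rewrite lerBlDl -lerBlDr le_max lexx orbT.
Qed.

Section ODE.
Variables (I : finType) (F : (I -> R) -> I -> R).

(** Differentiability gives continuity, uniformly in the coordinates because [I] is finite. *)
Lemma solution_close (J : set R) (x : R -> I -> R) (t r : R) : 0 < r ->
  (forall i, exists d, has_derivative_in J (x ^~ i) t d) ->
  exists2 h : R, 0 < h & forall s, J s -> `|s - t| <= h -> close r (x s) (x t).
Proof.
move=> r0 dx.
suff [h h0 hP] : exists2 h : R, 0 < h &
    forall i s, J s -> `|s - t| <= h -> `|x s i - x t i| <= r.
  by exists h => // s Js st i; exact: hP.
apply: finite_radius => [i h s _ sh hP u Ju us|i]; first exact/hP/(le_trans us).
have [d /has_derivative_inP/(_ 1 ltr01)[h h0 hP]] := dx i.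
have d1 : 0 < `|d| + 1 by rewrite ltr_wpDl.
exists (Num.min h (r / (`|d| + 1))); first by rewrite lt_min h0 divr_gt0.
move=> s Js; rewrite le_min => /andP[sh]; rewrite ler_pdivlMr// => sr.
have := ler_normD (x s i - x t i - (s - t) * d) ((s - t) * d).
have := hP s Js sh; rewrite subrK normrM; lra.
Qed.

(** On a time interval of length at most [r / 2], a bound [M] on the distance of the solutions
    bounds the derivative of their difference by [M / r]. Integrating improves the bound to [M / 2];
    iterating forces the distance to be 0. *)
Lemma ode_unique_local (x y : R -> I -> R) (a b : R) (p : I -> R) : a < b ->
  x a = p -> y a = p -> (forall i, lipschitz_fun_at (F ^~ i) p) ->
  solves [set t | a <= t <= b] F x -> solves [set t | a <= t <= b] F y ->
  exists2 r : R, 0 < r & forall s, a <= s -> s <= a + r -> s <= b -> x s = y s.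
Proof.
move=> ab xa ya Flip xF yF.
have Jab s : a <= s -> s <= b -> [set t | a <= t <= b] s.
  by move=> ? ?; apply/andP.
have Ja := Jab a (lexx a) (ltW ab).
(* [r] serves both as the radius and as the inverse of the Lipschitz constant,
   so that one application of [finite_radius] makes both uniform in [i]. *)
have [r r0 FL] : exists2 r : R, 0 < r & forall i u v (d : R), close r u p ->
    close r v p -> 0 <= d -> close d u v -> r * `|F u i - F v i| <= d.
  apply: (@finite_radius I (fun i r => forall u v (d : R), close r u p ->
    close r v p -> 0 <= d -> close d u v -> r * `|F u i - F v i| <= d)).
    move=> i r s s0 sr rP u v d up vp d0 uv.
    apply: le_trans (rP u v d _ _ d0 uv);
      [|exact: close_le up|exact: close_le vp].
    by rewrite ler_wpM2r.
  move=> i; have [r [L [r0 L0 FL]]] := Flip i.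
  have L1 : 0 < L + 1 by rewrite ltr_wpDl.
  have m0 : 0 < Num.min r (L + 1)^-1 by rewrite lt_min r0 invr_gt0.
  exists (Num.min r (L + 1)^-1) => // u v d up vp d0 uv.
  have {}FL : `|F u i - F v i| <= L * d.
    have mr : Num.min r (L + 1)^-1 <= r by rewrite ge_min lexx.
    by apply: FL d0 uv; [exact: close_le up|exact: close_le vp].
  apply: le_trans (_ : (L + 1)^-1 * (L * d) <= d).
    by apply: ler_pM => //; [exact: ltW|rewrite ge_min lexx orbT].
  by rewrite mulrC ler_pdivrMr//; nra.
have [h1 h1_gt0 xr] := solution_close r0 (fun i => ex_intro _ _ (xF a Ja i)).
have [h2 h2_gt0 yr] := solution_close r0 (fun i => ex_intro _ _ (yF a Ja i)).
rewrite xa in xr; rewrite ya in yr.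
pose h := Num.min (r / 2) (Num.min h1 h2).
have h0 : 0 < h by rewrite !lt_min h1_gt0 h2_gt0 divr_gt0.
have hr : h <= r / 2 by rewrite ge_min lexx.
have hh1 : h <= h1 by rewrite !ge_min lexx orbT.
have hh2 : h <= h2 by rewrite !ge_min lexx !orbT.
have xyr s : a <= s -> s <= a + h -> s <= b ->
    close r (x s) p /\ close r (y s) p.
  move=> as_ sh sb; have Js := Jab s as_ sb.
  by split; [apply: xr|apply: yr] => //; rewrite ger0_norm ?subr_ge0//; lra.
pose near M := forall s, a <= s -> s <= a + h -> s <= b -> close M (x s) (y s).
have halve M : 0 <= M -> near M -> near (M / 2).
  move=> M0 xyM s as_ sh sb i.
  have deriv t : a <= t <= s ->
      has_derivative_in [set t | a <= t <= s] (fun t => x t i - y t i) t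
        (F (x t) i - F (y t) i) /\ `|F (x t) i - F (y t) i| <= M / r.
    move=> /andP[at_ ts]; have tb := le_trans ts sb; have th := le_trans ts sh.
    have Jsb : [set t | a <= t <= s] `<=` [set t | a <= t <= b].
      by move=> u /andP[au us] /=; rewrite au (le_trans us).
    split.
      by apply: has_derivative_inB; apply: (has_derivative_in_subset Jsb);
        [exact: xF (Jab t at_ tb) i|exact: yF (Jab t at_ tb) i].
    have [xt yt] := xyr t at_ th tb.
    by rewrite ler_pdivlMr// mulrC; apply: FL => //; exact: xyM.
  have := mean_value as_ deriv.
  rewrite xa ya subrr subr0 => /le_trans; apply.
  rewrite -mulrA ler_wpM2l// mulrC ler_pdivrMr//; lra.
(* The first bound is [r *+ 2], both solutions being within [r] of [p]. *)
have nearn n : near (r *+ 2 / 2 ^+ n).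
  elim: n => [|n IH].
    move=> s as_ sh sb i; have [/(_ i) xs /(_ i) ys] := xyr s as_ sh sb.
    rewrite expr0 divr1 mulr2n.
    have := ler_normB (x s i - p i) (y s i - p i).
    have -> : x s i - p i - (y s i - p i) = x s i - y s i by ring.
    lra.
  rewrite exprSr invfM mulrA.
  by apply: halve => //; rewrite divr_ge0 ?exprn_ge0// mulrn_wge0// ltW.
exists h => // s as_ sh sb; apply/funext => i; apply/eqP.
rewrite -subr_eq0 -normr_le0 leNgt; apply/negP => D0.
set D := `|_| in D0.
(* This [n] has [r *+ 2 < n.+1 * D], hence [r *+ 2 < 2 ^+ n.+1 * D], against [nearn n.+1]. *)
have := truncnS_gt (r *+ 2 / D); set n := Num.truncn _.
rewrite ltr_pdivrMr// ltNge => /negP; apply.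
have := nearn n.+1 s as_ sh sb i.
rewrite -/D ler_pdivlMr ?exprn_gt0// => /(le_trans _); apply.
by rewrite mulrC ler_wpM2l ?(ltW D0)// -natrX ler_nat ltnW// ltn_expl.
Qed.

(** The Lipschitz condition concerns the trajectory of [y] alone. So a solution about which nothing
    is known can be compared with one that stays in the good region. *)
Theorem ode_unique (x y : R -> I -> R) (a b : R) :
  x a = y a ->
  (forall t, a <= t <= b -> forall i, lipschitz_fun_at (F ^~ i) (y t)) ->
  solves [set t | a <= t <= b] F x -> solves [set t | a <= t <= b] F y ->
  forall t, a <= t <= b -> x t = y t.
Proof.
move=> xya Flip xF yF; apply: real_induction => // t.
  move=> /andP[at_ tb] xyt; have Jt : a <= t <= b by rewrite at_ ltW.
  have sub : [set s | t <= s <= b] `<=` [set s | a <= s <= b].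
    by move=> s /= /andP[ts ->]; rewrite (le_trans at_).
  apply: (ode_unique_local tb xyt erefl (Flip t Jt)) => s Js i;
    apply: (has_derivative_in_subset sub);
    [exact: xF (sub s Js) i|exact: yF (sub s Js) i].
move=> /andP[at_ tb] xys; have Jt : [set t | a <= t <= b] t by rewrite /= ltW.
apply/funext => i; apply/eqP; rewrite -subr_eq0 -normr_le0.
apply/ler_addgt0Pr => e e0; rewrite add0r.
have e2 : 0 < e / 2 by rewrite divr_gt0.
have [h1 h1_gt0 xr] := solution_close e2 (fun i => ex_intro _ _ (xF t Jt i)).
have [h2 h2_gt0 yr] := solution_close e2 (fun i => ex_intro _ _ (yF t Jt i)).
(* A time just before [t], at which the solutions agree and each is within [e / 2] of its value at
   [t]. *)
pose s := Num.max a (t - Num.min h1 h2).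
have st : s < t by rewrite gt_max at_ ltrBlDr ltrDl lt_min h1_gt0.
have as_ : a <= s by rewrite le_max lexx.
have Js : [set t | a <= t <= b] s by rewrite /= as_ (le_trans (ltW st)).
have : t - s <= Num.min h1 h2 by rewrite lerBlDl -lerBlDr le_max lexx orbT.
rewrite le_min => /andP[sh1 sh2].
have ts : `|s - t| = t - s by rewrite distrC ger0_norm ?subr_ge0 ?ltW.
have := xr s Js; rewrite ts => /(_ sh1 i).
have := yr s Js; rewrite ts => /(_ sh2 i).
rewrite (xys s) ?as_// => h1' h2'.
have := ler_normB (y s i - y t i) (y s i - x t i).
have -> : y s i - y t i - (y s i - x t i) = x t i - y t i by ring.
lra.
Qed.

End ODE.
End Uniqueness.

(** * The product topology and the clamped arccosine *)

Section Clamp.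
Context {R : realType}.

Lemma prod_nbhs_close (I : finType) (l : I -> R) (r : R) : 0 < r ->
  nbhs (l : prod_topology (fun _ : I => (R : topologicalType)))
    [set m | close r m l].
Proof.
move=> r0; pose PT := prod_topology (fun _ : I => (R : topologicalType)).
apply: (@filter_forall _ _ (fun (i : I) (m : I -> R) => `|m i - l i| <= r) _
  (nbhs_filter (l : PT))) => i.
have li : nbhs (l i) [set y : R | `|y - l i| <= r].
  by exists r => //= y /= /ltW; rewrite distrC.
exact: (@proj_continuous I (fun=> R) i l _ li).
Qed.

(** Shows that nonnegative tuples are limits of positive ones, as the limit defining [angle_nonneg]
    requires. *)
Lemma prod_cvg_shift (I : Type) (l : I -> R) :
  (fun t : R => (fun i => l i + t) :
    prod_topology (fun _ : I => (R : topologicalType))) @ 0^'+ -->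
  (l : prod_topology (fun _ : I => (R : topologicalType))).
Proof.
apply/cvg_sup => i U [V [[W] oW <-] Wl WU].
apply: filterS WU _.
have h : (fun t => l i + t) @ 0^'+ --> l i + 0.
  by apply: cvgD; [exact: cvg_cst|exact: cvg_at_right_filter cvg_id].
rewrite addr0 in h; exact: (h W (open_nbhs_nbhs (conj oW Wl))).
Qed.

Definition acos_clamp (x : R) : R := acos (Num.max (-1) (Num.min 1 x)).

Lemma acos_clamp_cos (x : R) : -1 < x < 1 -> acos_clamp x = acos x.
Proof.
move=> /andP[/ltW x1 /ltW x2].
by rewrite /acos_clamp (min_idPr x2) (max_idPr x1).
Qed.

Lemma clamp_itv (x : R) : -1 <= Num.max (-1) (Num.min 1 x) <= 1.
Proof.
by rewrite le_max lexx/= ge_max ge_min lexx/= andbT; lra.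
Qed.

Lemma acos_clamp_ge0 (x : R) : 0 <= acos_clamp x.
Proof. exact/acos_ge0/clamp_itv. Qed.

Lemma acos_clamp_lepi (x : R) : acos_clamp x <= pi.
Proof. exact/acos_lepi/clamp_itv. Qed.

Lemma acos_clampE (x : R) :
  (if 1 <= x then 0 else if x <= -1 then pi else acos x) = acos_clamp x.
Proof.
have [x1|x1] := leP 1 x.
  by rewrite /acos_clamp (min_idPl x1) (max_idPr _) ?acos1//; lra.
have [x2|x2] := leP x (-1); last by rewrite acos_clamp_cos// x1 x2.
by rewrite /acos_clamp (min_idPr (ltW x1)) (max_idPl x2) acosN1.
Qed.

(** Continuity up to the endpoints, where differentiability fails: [acos] inverts the continuous
    [cos] on [[0, pi]]. *)
Lemma acos_within_continuous : {within `[(-1 : R), 1], continuous acos}.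
Proof.
have := @segment_can_ge_continuous R 0 pi cos acos (pi_ge0 R).
rewrite cos0 cospi; apply; last exact: cosK.
by apply: continuous_subspaceT => x; exact: continuous_cos.
Qed.

Lemma acos_clamp_continuous : continuous acos_clamp.
Proof.
move=> x.
have clampc : {for x, continuous (fun y : R => Num.max (-1) (Num.min 1 y))}.
  apply: continuous_max; first exact: cst_continuous.
  apply: continuous_min; first exact: cst_continuous.
  exact: cvg_id.
have /subspace_continuousP/(_ _ (clamp_itv x)) ac := acos_within_continuous.
move=> A /ac /clampc cA; apply: (@filterS _ (nbhs x) _ _ _ _ cA) => y; apply.
by rewrite /= in_itv/=; exact: clamp_itv.
Qed.

Lemma lipschitz_near_acos_clamp (c : R) : -1 < c < 1 ->
  lipschitz_near acos_clamp c.
Proof.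
move=> /[dup] c1 /lipschitz_near_acos[r [L [r0 L0 acosL]]].
pose s := Num.min r (Num.min (c + 1) (1 - c) / 2).
have s0 : 0 < s by rewrite lt_min r0 divr_gt0// lt_min; apply/andP; split; lra.
have sr : s <= r by rewrite ge_min lexx.
have sc : s <= Num.min (c + 1) (1 - c) / 2 by rewrite ge_min lexx orbT.
have [m1 m2] : Num.min (c + 1) (1 - c) <= c + 1 /\
    Num.min (c + 1) (1 - c) <= 1 - c.
  by rewrite !ge_min !lexx orbT.
have itv a : `|a - c| <= s -> -1 < a < 1 by rewrite ler_norml; lra.
exists s, L; split=> // a b ac bc; rewrite !acos_clamp_cos ?itv//.
by apply: acosL; [exact: le_trans ac sr|exact: le_trans bc sr].
Qed.

End Clamp.

(** * The extended angles as functions of the lengths *)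

Section Angles.
Context {R : realType}.
Implicit Types (l : tedge -> R).

Lemma cosh_sqr_sub (t : R) : cosh t ^+ 2 - sinh t ^+ 2 = 1.
Proof. by rewrite /cosh /sinh expRN; field; rewrite gt_eqF// expR_gt0. Qed.

Lemma sinh_sqr (t : R) : sinh t ^+ 2 = cosh t ^+ 2 - 1.
Proof. by rewrite -(cosh_sqr_sub t); ring. Qed.

Lemma cosh_ge1 (t : R) : 1 <= cosh t.
Proof.
rewrite /cosh expRN; set a := expR t.
have a0 : 0 < a by exact: expR_gt0.
rewrite -subr_ge0 (_ : _ - 1 = (a - 1) ^+ 2 / (2 * a)).
  by rewrite divr_ge0 ?sqr_ge0// mulr_ge0// ltW.
by field; rewrite gt_eqF.
Qed.

Lemma sinh_gt0 (t : R) : 0 < t -> 0 < sinh t.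
Proof. by move=> t0; rewrite divr_gt0// subr_gt0 ltr_expR; lra. Qed.

(** [c + Num.sqrt (c ^+ 2 - 1)] is the exponential of [arcosh c], and its conjugate is the
    exponential of [- arcosh c]. *)
Lemma arcosh_argument (c : R) : 1 <= c ->
  [/\ 0 <= c ^+ 2 - 1, 0 < c + Num.sqrt (c ^+ 2 - 1) &
    (c + Num.sqrt (c ^+ 2 - 1))^-1 = c - Num.sqrt (c ^+ 2 - 1)].
Proof.
move=> c1; have c2 : 0 <= c ^+ 2 - 1 by nra.
have u0 : 0 < c + Num.sqrt (c ^+ 2 - 1).
  by have := sqrtr_ge0 (c ^+ 2 - 1); lra.
split=> //; apply: (mulfI (lt0r_neq0 u0)).
by rewrite mulfV ?gt_eqF// mulrC -subr_sqr sqr_sqrtr//; ring.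
Qed.

Lemma cosh_arcosh (c : R) : 1 <= c -> cosh (arcosh c) = c.
Proof.
move=> /arcosh_argument[_ u0 uV].
by rewrite /cosh /arcosh expRN lnK ?posrE// uV; field.
Qed.

Lemma sinh_arcosh (c : R) : 1 <= c -> sinh (arcosh c) = Num.sqrt (c ^+ 2 - 1).
Proof.
move=> /arcosh_argument[_ u0 uV].
by rewrite /sinh /arcosh expRN lnK ?posrE// uV; field.
Qed.

(* [- triple_gram a b c] is the determinant of the Gram matrix with diagonal
   entries 1 and off-diagonal entries -a, -b, -c. *)
Definition triple_gram (a b c : R) : R :=
  2 * a * b * c + a ^+ 2 + b ^+ 2 + c ^+ 2 - 1.

(** The formula for [phi] with the factors [sinh] of the lengths cancelled, so that it stays
    meaningful when lengths vanish. *)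
Definition dihedral_cos l (i j k h : 'I_4) : R :=
  let c a b := cosh (l (ij a b)) in
  ((c i j * c i k + c j k) * (c i j * c i h + c j h)
    - (c i j ^+ 2 - 1) * (c i k * c i h + c k h)) /
  (Num.sqrt (triple_gram (c i j) (c i k) (c j k)) *
   Num.sqrt (triple_gram (c i j) (c i h) (c j h))).

Definition phi_ext l (e : tedge) : R :=
  dihedral_cos l (ends e).1 (ends e).2
    (opposite_ends e).1 (opposite_ends e).2.

Lemma triple_gram_gt0 (a b c : R) : 1 <= a -> 1 <= b -> 1 <= c ->
  0 < triple_gram a b c.
Proof.
move=> a1 b1 c1; rewrite /triple_gram.
have ab : 1 <= a * b by nra.
have abc : 1 <= a * b * c by nra.
nra.
Qed.

Lemma xlen_cosh_sinh l (i j k : 'I_4) : positive l ->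
  let c a b := cosh (l (ij a b)) in let s a b := sinh (l (ij a b)) in
  cosh (xlen l i j k) = (c i j * c i k + c j k) / (s i j * s i k) /\
  sinh (xlen l i j k) =
    Num.sqrt (triple_gram (c i j) (c i k) (c j k)) / (s i j * s i k).
Proof.
move=> lp c s.
have sE a b : s a b ^+ 2 = c a b ^+ 2 - 1 by exact: sinh_sqr.
have ss0 : 0 < s i j * s i k by rewrite mulr_gt0// sinh_gt0//; exact: lp.
(* [arcosh] inverts [cosh] only from 1 on; here the product of the [sinh] is at most that of the
   [cosh]. *)
have ge1 : 1 <= (c i j * c i k + c j k) / (s i j * s i k).
  rewrite ler_pdivlMr// mul1r.
  have c0 : 0 <= c i j * c i k.
    by rewrite mulr_ge0// (le_trans ler01)// cosh_ge1.
  have : s i j * s i k <= c i j * c i k.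
    rewrite -(@ler_pXn2r _ 2)// ?nnegrE ?(ltW ss0)//.
    rewrite [leLHS]exprMn [leRHS]exprMn !sE.
    have cj : 1 <= c i j by exact: cosh_ge1.
    have ck : 1 <= c i k by exact: cosh_ge1.
    nra.
  by have := cosh_ge1 (l (ij j k)); rewrite -/(c j k); lra.
split; first by rewrite /xlen cosh_arcosh.
have sE2 : (s i j * s i k) ^+ 2 = (c i j ^+ 2 - 1) * (c i k ^+ 2 - 1).
  by rewrite exprMn !sE.
rewrite /xlen sinh_arcosh//.
rewrite (_ : _ - 1 =
  triple_gram (c i j) (c i k) (c j k) / (s i j * s i k) ^+ 2).
  have t0 : 0 <= triple_gram (c i j) (c i k) (c j k).
    by rewrite ltW// triple_gram_gt0// cosh_ge1.
  by rewrite sqrtrM// sqrtrV ?sqr_ge0// sqrtr_sqr ger0_norm// ltW.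
rewrite expr_div_n -[X in _ - X](@divff _ ((s i j * s i k) ^+ 2)); last first.
  by rewrite expf_neq0// gt_eqF.
rewrite -mulrBl; congr (_ / _).
by rewrite sE2 /triple_gram -/(c i j) -/(c i k) -/(c j k); ring.
Qed.

Lemma phiE l e : positive l -> phi l e = phi_ext l e.
Proof.
move=> lp; rewrite /phi /phi_ext /dihedral_cos.
case: (ends e) (opposite_ends e) => i j [k h] /=.
have [cjk sjk] := xlen_cosh_sinh i j k lp.
have [cjh sjh] := xlen_cosh_sinh i j h lp.
have [ckh _] := xlen_cosh_sinh i k h lp.
rewrite cjk sjk cjh sjh ckh -(sinh_sqr (l (ij i j))).
have sn a b : sinh (l (ij a b)) != 0 by rewrite gt_eqF// sinh_gt0//; exact: lp.
have tn a b c :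
    Num.sqrt (triple_gram (cosh (l a)) (cosh (l b)) (cosh (l c))) != 0.
  by rewrite gt_eqF// sqrtr_gt0 triple_gram_gt0// cosh_ge1.
by field; rewrite !sn !tn.
Qed.

Lemma angle_posE l e : positive l -> angle_pos l e = acos_clamp (phi_ext l e).
Proof. by move=> lp; rewrite /angle_pos phiE// acos_clampE. Qed.

(** Holds at every [p], as the radicands are positive everywhere. Hence the angles can fail to be
    Lipschitz only through the arccosine. *)
Lemma dihedral_cos_lipschitz (i j k h : 'I_4) (p : tedge -> R) :
  lipschitz_fun_at (fun l => dihedral_cos l i j k h) p.
Proof.
have clip f : lipschitz_fun_at (fun m : tedge -> R => cosh (m f)) p.
  apply: lipschitz_fun_atM; last exact: lipschitz_fun_at_cst.
  apply: lipschitz_fun_atD; apply: lipschitz_fun_at_comp;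
    try exact: lipschitz_near_expR.
  - exact: lipschitz_fun_at_proj.
  - exact/lipschitz_fun_atN/lipschitz_fun_at_proj.
have tlip a b c : lipschitz_fun_at (fun m : tedge -> R =>
    triple_gram (cosh (m a)) (cosh (m b)) (cosh (m c))) p.
  rewrite /triple_gram.
  by repeat (exact: lipschitz_fun_at_cst || exact: clip ||
    apply: lipschitz_fun_atD || apply: lipschitz_fun_atM).
rewrite /dihedral_cos /=; apply: lipschitz_fun_atM.
  by repeat (exact: lipschitz_fun_at_cst || exact: clip ||
    apply: lipschitz_fun_atD || apply: lipschitz_fun_atM ||
    apply: lipschitz_fun_atN).
have t0 a b c :
    0 < Num.sqrt (triple_gram (cosh (p a)) (cosh (p b)) (cosh (p c))).
  by rewrite sqrtr_gt0 triple_gram_gt0// cosh_ge1.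
apply: lipschitz_fun_at_comp.
  by apply: lipschitz_near_inv; rewrite mulr_gt0.
by apply: lipschitz_fun_atM; apply: lipschitz_fun_at_comp (tlip _ _ _);
  apply: lipschitz_near_sqrt; rewrite -sqrtr_gt0.
Qed.

Lemma phi_ext_lipschitz e (p : tedge -> R) : lipschitz_fun_at (phi_ext ^~ e) p.
Proof. exact: dihedral_cos_lipschitz. Qed.

(** On positive tuples the angle is given by a formula continuous everywhere, so the limit is the
    value of that formula. *)
Lemma angle_extE l e :
  angle_ext l e = acos_clamp (phi_ext (fun e' => Num.max 0 (l e')) e).
Proof.
rewrite /angle_ext /angle_nonneg; set m := fun e' => Num.max 0 (l e').
have m0 e' : 0 <= m e' by rewrite le_max lexx.
pose PT := prod_topology (fun _ : tedge => (R : topologicalType)).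
have FF : ProperFilter (within (@positive R) (nbhs (m : PT))).
  apply: Build_ProperFilter => /=;
    last exact: (within_filter _ (nbhs_filter (m : PT))).
  move=> /= W.
  (* Adding a small [t > 0] to each entry of [m] gives positive tuples arbitrarily near [m]; so the
     filter is proper and the limit unique. *)
  have Wp : \forall t \near (0 : R)^'+, positive (fun e' => m e' + t) -> False.
    exact: prod_cvg_shift W.
  have pos : \forall t \near (0 : R)^'+, 0 < t by exact: nbhs_right_gt.
  have [t [/= t1 t0]] := filter_ex (filterI Wp pos).
  by apply: t1 => e' /=; have := m0 e'; lra.
apply: cvg_lim => //; apply/cvgrPdist_le => eps eps0.
have c : continuous_fun_at (fun m' => acos_clamp (phi_ext m' e)) m.
  apply: continuous_fun_at_comp; first exact: acos_clamp_continuous.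
  exact/lipschitz_fun_at_continuous/phi_ext_lipschitz.
have [r r0 rP] := c eps eps0.
apply: (@filterS _ (nbhs (m : PT)) _ _ _ _ (prod_nbhs_close m r0)).
move=> m' m'm m'p.
by rewrite angle_posE// distrC; exact: rP.
Qed.

Lemma angle_ext_ge0 l e : 0 <= angle_ext l e.
Proof. by rewrite angle_extE acos_clamp_ge0. Qed.

Lemma angle_ext_lepi l e : angle_ext l e <= pi.
Proof. by rewrite angle_extE acos_clamp_lepi. Qed.

Lemma phi_max0_lipschitz e (p : tedge -> R) :
  lipschitz_fun_at (fun l => phi_ext (fun e' => Num.max 0 (l e')) e) p.
Proof.
have [r [L [r0 L0 phiL]]] := phi_ext_lipschitz e (fun e' => Num.max 0 (p e')).
have max_close d l m : close d l m ->
    close d (fun e' => Num.max 0 (l e')) (fun e' => Num.max 0 (m e')).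
  by move=> lm e'; apply: le_trans (max0_contraction _ _) (lm e').
exists r, L; split=> // x y d xp yp d0 xy.
by apply: phiL d0 _; exact: max_close.
Qed.

End Angles.

(** * Linear algebra of the Minkowski form *)

Section Minkowski.
Context {R : realType}.
Implicit Types (x y z u v w p q : 'rV[R]_4).

Local Notation i1 := (lift ord0 ord0 : 'I_4).
Local Notation i2 := (lift ord0 (lift ord0 ord0) : 'I_4).
Local Notation i3 := (lift ord0 (lift ord0 (lift ord0 ord0)) : 'I_4).

Lemma minkE x y : mink x y =
  x 0 i1 * y 0 i1 + x 0 i2 * y 0 i2 + x 0 i3 * y 0 i3 - x 0 0 * y 0 0.
Proof.
by rewrite /mink big_mkcond/= !big_ord_recl big_ord0/= add0r addr0 !addrA.
Qed.

Lemma minkC x y : mink x y = mink y x.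
Proof. by rewrite !minkE; ring. Qed.

Lemma minkDl x y z : mink (x + y) z = mink x z + mink y z.
Proof. by rewrite !minkE !mxE; ring. Qed.

Lemma minkZl (a : R) x y : mink (a *: x) y = a * mink x y.
Proof. by rewrite !minkE !mxE; ring. Qed.

Lemma minkDr x y z : mink x (y + z) = mink x y + mink x z.
Proof. by rewrite !(minkC x) minkDl. Qed.

Lemma minkZr (a : R) x y : mink x (a *: y) = a * mink x y.
Proof. by rewrite !(minkC x) minkZl. Qed.

Lemma mink0l x : mink 0 x = 0.
Proof. by rewrite -(scale0r (0 : 'rV[R]_4)) minkZl mul0r. Qed.

Definition mink_bilinear := (minkDl, minkDr, minkZl, minkZr).

Lemma cauchy_schwarz3 (a b c x y z : R) :
  (a * x + b * y + c * z) ^+ 2 <=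
  (a ^+ 2 + b ^+ 2 + c ^+ 2) * (x ^+ 2 + y ^+ 2 + z ^+ 2).
Proof.
rewrite -subr_ge0 (_ : _ - _ = (a * y - b * x) ^+ 2 + (a * z - c * x) ^+ 2 +
  (b * z - c * y) ^+ 2); last by ring.
by rewrite !addr_ge0// sqr_ge0.
Qed.

Lemma rV4_eq0 x : x 0 i1 = 0 -> x 0 i2 = 0 -> x 0 i3 = 0 -> x 0 0 = 0 -> x = 0.
Proof.
move=> x1 x2 x3 x0; apply/rowP => i; rewrite mxE.
case: i => [[|[|[|[|//]]]] Hi].
- by rewrite -[RHS]x0; congr (x 0 _); exact: val_inj.
- by rewrite -[RHS]x1; congr (x 0 _); exact: val_inj.
- by rewrite -[RHS]x2; congr (x 0 _); exact: val_inj.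
- by rewrite -[RHS]x3; congr (x 0 _); exact: val_inj.
Qed.

(** The orthogonal complement of a timelike vector is spacelike. If [mink x x <= 0], Cauchy-Schwarz
    on the space coordinates gives [x0^2 p0^2 <= x0^2 (p0^2 - 1)], so [x0 = 0] and then [x = 0]. *)
Lemma mink_orth_gt0 p x : H3 p -> mink x p = 0 -> x != 0 -> 0 < mink x x.
Proof.
move=> [pp _] xp; apply: contraNT; rewrite -leNgt => xx; apply/eqP.
have := cauchy_schwarz3 (x 0 i1) (x 0 i2) (x 0 i3) (p 0 i1) (p 0 i2) (p 0 i3).
move: pp xp xx; rewrite !minkE => pp xp xx.
set P := (_ + _ in X in _ <= _ * X); set S := (X in _ <= X * _) => CS.
have P0 : 0 <= P by rewrite !addr_ge0// sqr_ge0.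
have PE : P = p 0 0 ^+ 2 - 1 by rewrite /P; lra.
have SE : S <= x 0 0 ^+ 2 by rewrite /S; lra.
have xpE : x 0 i1 * p 0 i1 + x 0 i2 * p 0 i2 + x 0 i3 * p 0 i3 = x 0 0 * p 0 0.
  by lra.
have x00 : x 0 0 ^+ 2 <= 0.
  rewrite xpE in CS; have := ler_wpM2r P0 SE; rewrite [in X in _ <= X]PE; nra.
have sq (t : R) : t ^+ 2 <= 0 -> t = 0.
  by move=> t0; apply/eqP; rewrite -sqrf_eq0 eq_le t0 sqr_ge0.
have [s1 s2 s3] :=
  And3 (sqr_ge0 (x 0 i1)) (sqr_ge0 (x 0 i2)) (sqr_ge0 (x 0 i3)).
by apply: rV4_eq0; apply: sq; rewrite /S in SE; lra.
Qed.

(** Reversed Cauchy-Schwarz, from [(s^2 - 1) (t^2 - 1) = (s t - 1)^2 - (s - t)^2] for the time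
    coordinates [s], [t]. *)
Lemma mink_H3_le p q : H3 p -> H3 q -> mink p q <= -1.
Proof.
move=> [pp p0] [qq q0].
have := cauchy_schwarz3 (p 0 i1) (p 0 i2) (p 0 i3) (q 0 i1) (q 0 i2) (q 0 i3).
move: pp qq; rewrite !minkE.
move: (p 0 0) (q 0 0) p0 q0 => s t s0 t0.
set P := (_ ^+ 2 + _ + _); set Q := (X in _ <= _ * X).
set a := (X in X ^+ 2 <= _) => pp qq CS.
have PE : P = s ^+ 2 - 1 by move: pp; rewrite /P; lra.
have QE : Q = t ^+ 2 - 1 by move: qq; rewrite /Q; lra.
have P0 : 0 <= P by rewrite !addr_ge0// sqr_ge0.
have Q0 : 0 <= Q by rewrite !addr_ge0// sqr_ge0.
have st : 1 <= s * t.
  have s1 : 1 <= s by nra.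
  have t1 : 1 <= t by nra.
  nra.
suff : a <= s * t - 1 by rewrite /a; lra.
rewrite leNgt; apply/negP => ast.
have : (s * t - 1) ^+ 2 < a ^+ 2 by rewrite ltr_pXn2r// nnegrE; lra.
rewrite PE QE in CS; have := sqr_ge0 (s - t); nra.
Qed.

Lemma rV4_basis u v w z :
  (forall a b c d : R, a *: u + b *: v + c *: w + d *: z = 0 ->
    [/\ a = 0, b = 0, c = 0 & d = 0]) ->
  forall x, exists a b c d : R, x = a *: u + b *: v + c *: w + d *: z.
Proof.
move=> free x; pose B : 'M[R]_4 := \matrix_i nth 0 [:: u; v; w; z] i.
have BE (y : 'rV[R]_4) : y *m B =
    y 0 0 *: u + y 0 i1 *: v + y 0 i2 *: w + y 0 i3 *: z.
  by rewrite mulmx_sum_row !big_ord_recl big_ord0 !rowK /= addr0 !addrA.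
have Bu : B \in unitmx.
  rewrite -row_free_unit -kermx_eq0; apply/rowV0P => y /sub_kermxP.
  by rewrite BE => /free[y0 y1 y2 y3]; exact: rV4_eq0.
have := BE (x *m invmx B); rewrite mulmxKV// => xE.
by do 4 eexists; exact: xE.
Qed.

End Minkowski.

(** * Combinatorics of edges and opposite edges *)

Section TruncatedTetrahedronEdges.
Implicit Types (A : {set 'I_4}) (i j k h : 'I_4) (e : tedge).

Lemma two_elementsP A : #|A| == 2%N -> exists x y,
  [/\ two_elements A = (x, y), x != y & A = [set x; y]%SET].
Proof.
rewrite cardE /two_elements; have := enum_uniq A; have := mem_enum A.
case: (enum A) => [|x [|y []]]//= memA /andP[xy _] _.
exists x, y; split=> //; first by move: xy; rewrite inE.
by apply/setP => z; rewrite -memA !inE.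
Qed.

Lemma cards2_neq i j : i != j -> #|[set i; j]%SET| == 2%N.
Proof. by move=> ij_; rewrite cards2 ij_. Qed.

Lemma val_ij i j : i != j -> val (ij i j) = [set i; j]%SET.
Proof. by move=> ij_; rewrite /ij insubdK//; exact: cards2_neq. Qed.

Lemma cards_compl2 A : #|A| == 2%N -> #|(~: A)%SET| == 2%N.
Proof. by move=> /eqP A2; rewrite cardsCs finset.setCK A2 card_ord. Qed.

Lemma complement_uniq i j k h : i != j -> k != h ->
  (~: [set i; j] = [set k; h])%SET -> uniq [:: i; j; k; h].
Proof.
move=> ij_ kh /setP E; have := E i; have := E j; rewrite !inE !eqxx orbT/=.
move=> /esym/negbT; rewrite negb_or => /andP[jk jh].
move=> /esym/negbT; rewrite negb_or => /andP[ik ih].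
by rewrite /= !inE !negb_or ij_ ik ih jk jh kh.
Qed.

Lemma complement2 i j : i != j -> exists k h, uniq [:: i; j; k; h].
Proof.
move=> ij_.
have [k [h [_ kh E]]] := two_elementsP (cards_compl2 (cards2_neq ij_)).
by exists k, h; exact: complement_uniq.
Qed.

Lemma ends_uniq e : exists i j k h,
  [/\ ends e = (i, j), opposite_ends e = (k, h) & uniq [:: i; j; k; h]].
Proof.
have [i [j [eij ij_ E]]] := two_elementsP (valP e).
have [k [h [ekh kh E']]] := two_elementsP (cards_compl2 (valP e)).
exists i, j, k, h; split=> //; apply: complement_uniq => //.
by rewrite -E' -E.
Qed.

End TruncatedTetrahedronEdges.

(** * The cosine law for the dihedral angles of a hyper-ideal tetrahedron *)

Section HyperidealTetrahedron.
Context {R : realType}.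

(* [a], [b], [c] (resp. [a'], [b'], [d']) are the coordinates of the normal of
   the triangle k (resp. h) along the normals of the triangles i, j and of the
   hexagon k (resp. h), in the basis formed by the normals of the triangles i, j
   and of the hexagons k, h; [g] is the product of the last two. *)
Lemma dihedral_cos_coordinates (cij cik cjk cih cjh ckh g : R)
    (a b c a' b' d' : R) :
  1 < cij -> -1 < g < 1 -> c < 0 -> d' < 0 ->
  a - b * cij = - cik -> b - a * cij = - cjk ->
  a' - b' * cij = - cih -> b' - a' * cij = - cjh ->
  - (a * cik + b * cjk) + c ^+ 2 * (1 - g ^+ 2) = 1 ->
  - (a' * cih + b' * cjh) + d' ^+ 2 * (1 - g ^+ 2) = 1 ->
  - (a' * cik + b' * cjk) - c * d' * g * (1 - g ^+ 2) = - ckh ->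
  ((cij * cik + cjk) * (cij * cih + cjh)
    - (cij ^+ 2 - 1) * (cik * cih + ckh)) /
  (Num.sqrt (triple_gram cij cik cjk) * Num.sqrt (triple_gram cij cih cjh))
  = - g.
Proof.
move=> c1 g1 c0 d0 A B A' B' N N' NN.
set s := cij ^+ 2 - 1; have s0 : 0 < s by rewrite /s; nra.
set r := 1 - g ^+ 2 in N N' NN *; have r0 : 0 < r by rewrite /r; nra.
have as_ : a * s = cik + cij * cjk by rewrite /s; nra.
have bs : b * s = cjk + cij * cik by rewrite /s; nra.
have as' : a' * s = cih + cij * cjh by rewrite /s; nra.
have bs' : b' * s = cjh + cij * cih by rewrite /s; nra.
have D : triple_gram cij cik cjk = s * (c ^+ 2 * r).
  have -> : c ^+ 2 * r = 1 + (a * cik + b * cjk) by rewrite -N; ring.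
  have -> : s * (1 + (a * cik + b * cjk)) = s + (a * s * cik + b * s * cjk).
    by ring.
  by rewrite as_ bs /s /triple_gram; ring.
have D' : triple_gram cij cih cjh = s * (d' ^+ 2 * r).
  have -> : d' ^+ 2 * r = 1 + (a' * cih + b' * cjh) by rewrite -N'; ring.
  have -> : s * (1 + (a' * cih + b' * cjh)) = s + (a' * s * cih + b' * s * cjh).
    by ring.
  by rewrite as' bs' /s /triple_gram; ring.
have Nn : (cij * cik + cjk) * (cij * cih + cjh) - s * (cik * cih + ckh)
    = s * (- (c * d' * g * r)).
  have -> : - (c * d' * g * r) = - ckh + (a' * cik + b' * cjk) by lra.
  have -> : s * (- ckh + (a' * cik + b' * cjk)) =
    - s * ckh + (a' * s * cik + b' * s * cjk) by ring.
  by rewrite as' bs' /s; ring.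
have cd : 0 < c * d' by rewrite nmulr_rgt0.
rewrite Nn -sqrtrM; last first.
  by rewrite D mulr_ge0 ?ltW// mulr_gt0// exprn_even_gt0//= lt_eqF.
rewrite D D'.
have -> : s * (c ^+ 2 * r) * (s * (d' ^+ 2 * r)) = (s * (c * d' * r)) ^+ 2.
  by ring.
rewrite sqrtr_sqr ger0_norm; last by rewrite ltW// mulr_gt0// mulr_gt0.
by field; rewrite (gt_eqF s0) (gt_eqF r0) (lt_eqF c0) (lt_eqF d0).
Qed.

Variable D : @truncated_data R.
Hypothesis HD : hyperideal D.

Local Notation v := (trin D).
Local Notation n := (hexn D).
Local Notation p := (vtx D).

Section Edge.
Variables i j k h : 'I_4.
Hypothesis ijkh : uniq [:: i; j; k; h].

Let neqs : [/\ i != j, i != k, i != h & [/\ j != k, j != h & k != h]] /\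
  [/\ j != i, k != i, h != i & [/\ k != j, h != j & h != k]].
Proof.
move: ijkh; rewrite /= !inE !negb_or.
move=> /and4P[/and3P[ij_ ik ih] /andP[jk jh] kh _].
rewrite ij_ ik ih jk jh kh.
rewrite !(eq_sym _ i) (eq_sym k j) (eq_sym h j) (eq_sym h k).
by rewrite ij_ ik ih jk jh kh.
Qed.

(** Pair the relation with vertices: [p i j] and [p j i] isolate [b] and [a], then [p i k] and
    [p i h] isolate [c] and [d], each with a negative factor. *)
Lemma edge_free (a b c d : R) :
  a *: v i + b *: v j + c *: n k + d *: n h = 0 ->
  [/\ a = 0, b = 0, c = 0 & d = 0].
Proof.
have [[ij_ ik ih [jk jh kh]] [ji ki hi [kj hj hk]]] := neqs.
move=> E; have pair x : a * mink x (v i) + b * mink x (v j) +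
    c * mink x (n k) + d * mink x (n h) = 0.
  by rewrite -!minkZr -!minkDr E minkC mink0l.
have mul_neg_eq0 (s t : R) : s * t = 0 -> t < 0 -> s = 0.
  by move=> /eqP; rewrite mulf_eq0 => /orP[/eqP//|/eqP->]; rewrite ltxx.
have b0 : b = 0.
  apply: mul_neg_eq0 (vtx_off_tri HD ij_ ji); have := pair (p i j).
  rewrite (vtx_on_tri HD ij_) (vtx_on_hex HD ij_ ki kj).
  rewrite (vtx_on_hex HD ij_ hi hj).
  by rewrite !mulr0 add0r !addr0.
have a0 : a = 0.
  apply: mul_neg_eq0 (vtx_off_tri HD ji ij_); have := pair (p j i).
  rewrite (vtx_on_tri HD ji) (vtx_on_hex HD ji kj ki) (vtx_on_hex HD ji hj hi).
  by rewrite !mulr0 !addr0.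
have c0 : c = 0.
  apply: mul_neg_eq0 (vtx_off_hex HD ik).2; have := pair (p i k).
  by rewrite a0 b0 (vtx_on_hex HD ik hi hk) !mul0r mulr0 !add0r addr0.
have d0 : d = 0.
  apply: mul_neg_eq0 (vtx_off_hex HD ih).2; have := pair (p i h).
  by rewrite a0 b0 (vtx_on_hex HD ih ki kh) !mul0r mulr0 !add0r.
by split.
Qed.

(** [n k + n h] and [n k - n h] are nonzero and orthogonal to the point [p i j] of [H3], hence
    spacelike; their squares are [2 + 2 g] and [2 - 2 g], for [g] the product of the normals. *)
Lemma hexn_mink_itv : -1 < mink (n k) (n h) < 1.
Proof.
have [[ij_ ik ih [jk jh kh]] [ji ki hi [kj hj hk]]] := neqs.
have pos (s : R) : 0 < mink (n k + s *: n h) (n k + s *: n h).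
  apply: (mink_orth_gt0 (vtx_H3 HD ij_)).
    rewrite minkC !mink_bilinear.
    by rewrite (vtx_on_hex HD ij_ ki kj) (vtx_on_hex HD ij_ hi hj); ring.
  apply/eqP => E; have [|_ _ /eqP] := @edge_free 0 0 1 s.
    by rewrite !scale0r !add0r scale1r.
  by rewrite oner_eq0.
have := pos 1; have := pos (-1).
rewrite !mink_bilinear !(hexn_unit HD) (minkC (n h)).
by move=> ? ?; apply/andP; split; lra.
Qed.

(** The vertex is orthogonal to [n k] and [n h], whose Gram determinant [1 - g ^+ 2] is nonzero, so
    its components along them vanish. Stating it for [a], [b] covers both ends of the edge. *)
Lemma edge_vtx_coord (a b : 'I_4) : [set a; b]%SET = [set i; j]%SET -> a != b ->
  exists s t : R, p a b = s *: v i + t *: v j.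
Proof.
move=> abE ab.
have [[ij_ ik ih [jk jh kh]] [ji ki hi [kj hj hk]]] := neqs.
have kab : k \notin [set a; b]%SET by rewrite abE !inE negb_or ki kj.
have hab : h \notin [set a; b]%SET by rewrite abE !inE negb_or hi hj.
have [ka kb] : k != a /\ k != b by move: kab; rewrite !inE negb_or => /andP.
have [ha hb] : h != a /\ h != b by move: hab; rewrite !inE negb_or => /andP.
have [s [t [c [d E]]]] := rV4_basis edge_free (p a b).
have g1 := hexn_mink_itv; set g := mink (n k) (n h) in g1.
have g20 : 1 - g ^+ 2 != 0 by rewrite gt_eqF//; nra.
have := vtx_on_hex HD ab ka kb; have := vtx_on_hex HD ab ha hb.
rewrite E !mink_bilinear !(hexn_unit HD) (minkC (n h)) -/g.
rewrite !(tri_orth_hex HD)// !mulr0 !add0r !mulr1 => e1 e2.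
have c0 : c = 0 by apply: (mulIf g20); nra.
have d0 : d = 0 by rewrite c0 in e1; lra.
by exists s, t; rewrite c0 d0 !scale0r !addr0.
Qed.

(* [p i j] and [p j i] lie in the Lorentzian plane spanned by [v i] and [v j],
   where the product g of the latter determines everything:
   [p i j = (v j - g v i) / sqrt (g^2 - 1)]. *)
Lemma edge_relations : [/\ mink (v i) (v j) = mink (p i j) (p j i),
  mink (v i) (v j) < -1 & mink (v i) (n i) < 0].
Proof.
have [[ij_ ik ih [jk jh kh]] [ji ki hi [kj hj hk]]] := neqs.
have [a [b E]] := edge_vtx_coord erefl ij_.
have [b' [a' E']] := edge_vtx_coord (finset.setUC _ _) ji.
have u1 := trin_unit HD i; have u2 := trin_unit HD j.
have [pp _] := vtx_H3 HD ij_; have [pp' _] := vtx_H3 HD ji.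
have le1 := mink_H3_le (vtx_H3 HD ij_) (vtx_H3 HD ji).
have z := vtx_on_tri HD ij_; have z' := vtx_on_tri HD ji.
have lt := vtx_off_tri HD ij_ ji; have lt' := vtx_off_tri HD ji ij_.
have [hi_ _] := vtx_off_hex HD ij_.
have vjni := tri_orth_hex HD ji.
move: z z' lt lt' pp pp' le1 hi_.
rewrite E E' !mink_bilinear u1 u2 (minkC (v j)) vjni.
set g := mink (v i) (v j); set d := mink (v i) (n i).
rewrite !mulr1 mulr0 addr0 => z z' lt lt' pp pp' le1 hi_.
have aE : a = - b * g by lra.
have bE' : a' = - b' * g by lra.
rewrite aE bE' in lt lt' pp pp' le1 hi_ *.
have b2 : b ^+ 2 * (g ^+ 2 - 1) = 1 by lra.
have b2' : b' ^+ 2 * (g ^+ 2 - 1) = 1 by lra.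
have g2 : 0 < g ^+ 2 - 1.
  rewrite ltNge; apply/negP => g2; have := sqr_ge0 b; nra.
have b0 : 0 < b by nra.
have b0' : 0 < b' by nra.
have bb : b' = b.
  apply/eqP; rewrite -(eqrXn2 (n := 2))// ?ltW//; apply/eqP.
  by apply: (mulIf (lt0r_neq0 g2)); rewrite b2 b2'.
subst b'.
have gE : b * b * (g ^+ 2 - 1) * g = g by rewrite -expr2 b2 mul1r.
have g0 : g < 0 by nra.
by split; [rewrite -[LHS]gE; ring|nra|nra].
Qed.

End Edge.

Lemma mink_trin (i j : 'I_4) : i != j ->
  mink (v i) (v j) = - cosh (edge_length D (ij i j)) /\
  1 < cosh (edge_length D (ij i j)).
Proof.
move=> ij_; have [k [h ijkh]] := complement2 ij_.
have [vp v1 _] := edge_relations ijkh.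
suff -> : edge_length D (ij i j) = hdist (p i j) (p j i).
  by rewrite /hdist cosh_arcosh -?vp; [split; lra|lra].
(* [ends] may list the two ends in either order; [hdist] is symmetric. *)
rewrite /edge_length /ends val_ij//.
have [x [y [-> xy]]] := two_elementsP (cards2_neq ij_).
have pC : hdist (p j i) (p i j) = hdist (p i j) (p j i) by rewrite /hdist minkC.
move=> /setP E; have := E x; have := E y; rewrite !inE !eqxx orbT/=.
move=> /orP[/eqP yi|/eqP yj] /orP[/eqP xi|/eqP xj]; subst => //.
- by rewrite eqxx in xy.
- by rewrite eqxx in xy.
Qed.

Lemma trin_hexn_lt0 (i : 'I_4) : mink (v i) (n i) < 0.
Proof.
have [j ji] : exists j : 'I_4, i != j.
  have [->|] := eqVneq i ord0; last by exists ord0.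
  by exists ord_max.
have [k [h ijkh]] := complement2 ji.
by have [] := edge_relations ijkh.
Qed.

(** Expand [v k] and [v h] in the basis [v i], [v j], [n k], [n h]; pairing the expansions with the
    normals yields the premises of [dihedral_cos_coordinates]. *)
Lemma dihedral_cos_hexn (l : tedge -> R) (i j k h : 'I_4) :
  uniq [:: i; j; k; h] -> (forall e, edge_length D e = l e) ->
  dihedral_cos l i j k h = - mink (n k) (n h).
Proof.
move=> ijkh lE.
move: (ijkh); rewrite /= !inE !negb_or.
move=> /and4P[/and3P[ij_ ik ih] /andP[jk jh] kh _].
have g1 := hexn_mink_itv ijkh.
have [a [b [c [d E]]]] := rV4_basis (edge_free ijkh) (v k).
have [a' [b' [c' [d' E']]]] := rV4_basis (edge_free ijkh) (v h).
have cE x y : x != y -> mink (v x) (v y) = - cosh (l (ij x y)).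
  by rewrite -lE => /mink_trin[].
have c1 : 1 < cosh (l (ij i j)) by rewrite -lE; have [] := mink_trin ij_.
rewrite /dihedral_cos /=; set g := mink (n k) (n h) in g1 *.
have dk := trin_hexn_lt0 k; have dh := trin_hexn_lt0 h.
have ki : k != i by rewrite eq_sym.
have kj : k != j by rewrite eq_sym.
have hi : h != i by rewrite eq_sym.
have hj : h != j by rewrite eq_sym.
have hk : h != k by rewrite eq_sym.
have o x y : x != y -> mink (n y) (v x) = 0.
  by move=> xy; rewrite minkC (tri_orth_hex HD).
have vv x : mink (v x) (v x) = 1 := trin_unit HD x.
have nn x : mink (n x) (n x) = 1 := hexn_unit HD x.
have nhk : mink (n h) (n k) = g by rewrite minkC.
have vji : mink (v j) (v i) = - cosh (l (ij i j)) by rewrite minkC cE.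
have pairk x : mink (v k) x =
    a * mink (v i) x + b * mink (v j) x + c * mink (n k) x + d * mink (n h) x.
  by rewrite {1}E !mink_bilinear.
have pairh x : mink (v h) x =
    a' * mink (v i) x + b' * mink (v j) x +
    c' * mink (n k) x + d' * mink (n h) x.
  by rewrite {1}E' !mink_bilinear.
have ekh := pairk (n h).
rewrite (tri_orth_hex HD kh) !(tri_orth_hex HD)// nn -/g in ekh.
have ekk := pairk (n k).
rewrite [in RHS](tri_orth_hex HD ik) (tri_orth_hex HD jk) nn nhk in ekk.
have ehk := pairh (n k).
rewrite (tri_orth_hex HD hk) !(tri_orth_hex HD)// nn nhk in ehk.
have ehh := pairh (n h).
rewrite [in RHS](tri_orth_hex HD ih) (tri_orth_hex HD jh) nn -/g in ehh.
have eki := pairk (v i); rewrite minkC (cE _ _ ik) vv vji !o// in eki.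
have ekj := pairk (v j); rewrite minkC (cE _ _ jk) vv (cE _ _ ij_) !o// in ekj.
have ehi := pairh (v i); rewrite minkC (cE _ _ ih) vv vji !o// in ehi.
have ehj := pairh (v j); rewrite minkC (cE _ _ jh) vv (cE _ _ ij_) !o// in ehj.
have ekk' := pairk (v k); rewrite vv (cE _ _ ik) (cE _ _ jk) (o k h)// in ekk'.
have ehh' := pairh (v h); rewrite vv (cE _ _ ih) (cE _ _ jh) (o h k)// in ehh'.
have ehk' := pairh (v k).
rewrite minkC (cE _ _ kh) (cE _ _ ik) (cE _ _ jk) (o k h)// in ehk'.
have r0 : 0 < 1 - g ^+ 2 by move: g1; clear; nra.
(* Orthogonality of [v k] to [n h], and of [v h] to [n k], eliminates [d] and [c']. *)
have dE : d = - c * g by move: ekh; clear; lra.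
have c'E : c' = - d' * g by move: ehk; clear; lra.
have dkE : mink (v k) (n k) = c * (1 - g ^+ 2) by rewrite ekk dE; ring.
have dhE : mink (v h) (n h) = d' * (1 - g ^+ 2) by rewrite ehh c'E; ring.
rewrite minkC dkE in ekk'; rewrite minkC dhE in ehh'.
rewrite [mink (n k) (v k)]minkC dkE c'E in ehk'.
apply: (@dihedral_cos_coordinates _ _ _ _ _ _ g a b c a' b' d') => //.
- by rewrite -(pmulr_llt0 _ r0) -dkE.
- by rewrite -(pmulr_llt0 _ r0) -dhE.
all: by move: eki ekj ehi ehj ekk' ehh' ehk'; clear; lra.
Qed.

End HyperidealTetrahedron.

(** Every tetrahedron with lengths [l] has the angle computed in [main], so the one picked by [get]
    does not matter. *)
Lemma hyperideal_lengths_angle {R : realType} (l : tedge -> R) (e : tedge) :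
  hyperideal_lengths l ->
  -1 < phi_ext l e < 1 /\ angle l e = acos (phi_ext l e).
Proof.
move=> [_ HL].
have main D : hyperideal D -> (forall e', edge_length D e' = l e') ->
    -1 < phi_ext l e < 1 /\ dihedral_angle D e = acos (phi_ext l e).
  move=> HD lE; rewrite /phi_ext /dihedral_angle.
  have [i [j [k [h [-> -> ijkh]]]]] := ends_uniq e.
  rewrite (dihedral_cos_hexn HD ijkh lE).
  have := hexn_mink_itv HD ijkh; move: (mink _ _) => g g1.
  by rewrite acosN; [split=> //|]; lra.
have [D [HD lE]] := HL.
split; first by have [] := main D HD lE.
rewrite /angle; set S := [set a | _].
have [D' [HD' lE' ->]] : S (get S).
  by apply: getPex; exists (dihedral_angle D e), D.
by have [] := main D' HD' lE'.
Qed.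

(** * Boundedness, continuity and local Lipschitz property of the curvature *)

Section RicciCurvature.
Context {R : realType} {M : topologicalType} (Tri : ideal_triangulation R M).
Implicit Types (l p : edge Tri -> R) (e : edge Tri).

Lemma max0_restrict l (s : tet Tri) : hyperideal_metric l ->
  (fun e' : tedge => Num.max 0 (Defs.restrict l s e')) = Defs.restrict l s.
Proof.
move=> [l0 _]; apply/funext => e' /=.
by rewrite (max_idPr _)// ltW//; exact: l0.
Qed.

Lemma ricci_extE l e : hyperideal_metric l -> ricci l e = ricci_ext l e.
Proof.
move=> lm; have [_ lH] := lm; rewrite /ricci /ricci_ext; congr (_ - _).
apply: eq_bigr => u _.
have [phi1 ->] := hyperideal_lengths_angle u.2 (lH u.1).
by rewrite angle_extE max0_restrict// acos_clamp_cos.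
Qed.

Lemma ricci_ext_bounded : exists C : R, 0 <= C /\
  forall l e, `|ricci_ext l e| <= C.
Proof.
have pi0 : 0 <= (pi : R) := pi_ge0 R.
(* Summing over all edges of all tetrahedra makes the bound independent of [e]. *)
exists (2 * pi + \sum_(u : tet Tri * tedge) pi); split.
  by rewrite addr_ge0 ?mulr_ge0// sumr_ge0.
move=> l e; rewrite /ricci_ext; apply: le_trans (ler_normB _ _) _.
rewrite ger0_norm ?mulr_ge0// lerD2l ger0_norm; last first.
  by apply: sumr_ge0 => u _; exact: angle_ext_ge0.
rewrite big_mkcond/=; apply: ler_sum => u _; case: ifP => // _.
exact: angle_ext_lepi.
Qed.

Let term_continuous (u : tet Tri * tedge) p :
  continuous_fun_at (fun l => angle_ext (Defs.restrict l u.1) u.2) p.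
Proof.
under eq_fun do rewrite angle_extE.
apply: continuous_fun_at_comp; first exact: acos_clamp_continuous.
apply: lipschitz_fun_at_continuous.
exact: (lipschitz_fun_at_precomp (phi_max0_lipschitz _ _)).
Qed.

Lemma ricci_ext_continuous p e : continuous_fun_at (fun l => ricci_ext l e) p.
Proof.
by apply: continuous_fun_at_cstB; apply: continuous_fun_at_sum => u;
  exact: term_continuous.
Qed.

Lemma ricci_ext_lipschitz p e : hyperideal_metric p ->
  lipschitz_fun_at (fun l => ricci_ext l e) p.
Proof.
move=> pm; have [_ pH] := pm.
apply: lipschitz_fun_atD; first exact: lipschitz_fun_at_cst.
apply: lipschitz_fun_atN; apply: lipschitz_fun_at_sum => u.
under eq_fun do rewrite angle_extE.
apply: lipschitz_fun_at_comp.
  apply: lipschitz_near_acos_clamp.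
  have [+ _] := hyperideal_lengths_angle u.2 (pH u.1).
  by rewrite max0_restrict.
exact: (lipschitz_fun_at_precomp (phi_max0_lipschitz _ _)).
Qed.

End RicciCurvature.

Theorem theorem1p1 (R : realType) (M : topologicalType)
    (Tri : ideal_triangulation R M)
    (hchi : forall C : set M, boundary_component R C -> euler_char Tri C < 0)
    (l0 : edge Tri -> R) (hl0 : hyperideal_metric l0) :
  exists lt : R -> edge Tri -> R,
    [/\ C1_on [set t | 0 <= t] lt,
        lt 0 = l0,
        solves [set t | 0 <= t] (@ricci_ext R M Tri) lt &
        forall (tau : \bar R) (l : R -> edge Tri -> R),
          (0 < tau)%E ->
          l 0 = l0 ->
          (forall t : R, 0 <= t -> (t%:E < tau)%E -> hyperideal_metric (l t)) ->
          solves [set t | 0 <= t /\ (t%:E < tau)%E] (@ricci R M Tri) l ->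
          forall t : R, 0 <= t -> (t%:E < tau)%E -> lt t = l t].
Proof.
have [C [C0 FC]] := ricci_ext_bounded Tri.
have Fc := @ricci_ext_continuous R M Tri.
have [lt [lt0 lt_lip lt_der]] := peano_existence l0 C0 FC Fc.
have lt_sol : solves [set t | 0 <= t] (@ricci_ext R M Tri) lt.
  by move=> t t0 i; apply/has_derivative_inP => e; exact: lt_der.
exists lt; split=> //.
  move=> i; exists (fun t => ricci_ext (lt t) i).
    by move=> t t0; exact: lt_sol.
  apply/subspace_continuousP => t t0; apply/cvgrPdist_le => e e0.
  have [r r0 rP] := Fc (lt t) i e e0.
  have C1 : 0 < C + 1 by rewrite ltr_wpDl.
  (* [lt] is [C]-Lipschitz, so this keeps [lt s] within [r] of [lt t]. *)
  exists (r / (C + 1)) => /=; first by rewrite divr_gt0.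
  move=> s; rewrite /ball_/= => st s0; rewrite distrC; apply: rP => j.
  apply: le_trans (lt_lip s t j s0 t0) _; rewrite distrC.
  by move: st; rewrite ltr_pdivlMr//; have := normr_ge0 (t - s); nra.
move=> tau l tau0 l_0 lH l_sol t t0 ttau.
have below s : s <= t -> (s%:E < tau)%E.
  by move=> st; apply: le_lt_trans ttau; rewrite lee_fin.
(* Uniqueness on the compact interval [[0, t]], on which [l] is hyper-ideal and thus also solves the
   extended flow. *)
apply: (@ode_unique R _ (@ricci_ext R M Tri) lt l 0 t) => //.
- by rewrite lt0.
- move=> s /andP[s0 st] i; apply: ricci_ext_lipschitz; exact: lH (below s st).
- move=> s /andP[s0 st] i.
  apply: (@has_derivative_in_subset R [set t | 0 <= t]); last exact: lt_sol.
  by move=> u /andP[].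
- move=> s /andP[s0 st] i; rewrite -ricci_extE; last exact: lH (below s st).
  apply: (has_derivative_in_subset _ (l_sol s _ i)); last by split=> //;
    exact: below.
  by move=> u /= /andP[u0 ut]; split=> //; exact: below.
- by rewrite t0 lexx.
Qed.
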